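(* Let $G\neq\{0\}$ be a divisible ordered abelian group which is an exponential group (in some Archimedean group $C$). Then there is a real closed field $(K,+,\cdot,0,1,<)$ with value group $v(K^\times)=G$ (with respect to the natural valuation $v$) such that $K$ has no integer part whose non-negative cone is a model of Peano Arithmetic.
   Context: Rank and Archimedean components of a divisible ordered abelian group $(G,+,0,<)$: for non-zero $x,y\in G$ put $x\sim y$ if there is $n\in\mathbb{N}$ with $n|x|\ge|y|$ and $n|y|\ge|x|$, and write $x\ll y$ if $n|x|<|y|$ for all $n\in\mathbb{N}$. Let $[x]$ be the $\sim$-class of $x$. The rank of $G$ is $\Gamma=\{[x]:x\in G\setminus\{0\}\}$, totally ordered by $[y]<[x]$ iff $x\ll y$. The natural valuation is $v(x)=[x]$ for $x\neq0$ and $v(0)=\infty$. For $\gamma\in\Gamma$, the Archimedean component $B_\gamma$ is a maximal Archimedean subgroup of $G$ containing some chosen $x\in\gamma$ (up to isomorphism of ordered groups, $\{x:v(x)\ge\gamma\}/\{x:v(x)>\gamma\}$). Exponential group: $G$ is an exponential group in an Archimedean ordered group $C$ if $\Gamma$ is isomorphic as a linear order to the negative cone $G^{<0}$ and each $B_\gamma$ is isomorphic to $C$ as an ordered group. Value group of a real closed field $K$: the natural valuation $v$ of $K$ is the natural valuation of the ordered group $(K,+,0,<)$; the value set $v(K^\times)$ with addition $v(x)+v(y)=v(xy)$ is a divisible ordered abelian group, the value group of $K$. The equality $v(K^\times)=G$ is understood up to isomorphism of ordered groups. Integer part: an integer part of an ordered field $R$ is a discretely ordered subring $Z\subseteq R$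 such that for every $r\in R$ there is $z\in Z$ with $z\le r<z+1$. Its non-negative cone is $Z^{\ge0}$, regarded as a structure in $\{+,\cdot,0,1,<\}$. Peano Arithmetic is the theory of non-negative cones of discretely ordered commutative rings with $1$ together with induction for every first-order formula of $\{+,\cdot,0,1,<\}$. *)

(* Defs.v *)
From HB Require Import structures.
From mathcomp Require Import all_boot all_order all_algebra.
From mathcomp Require Import boolp classical_sets functions.

Set Implicit Arguments.
Unset Strict Implicit.
Unset Printing Implicit Defensive.

Import Order.TTheory GRing.Theory Num.Theory.
Local Open Scope classical_set_scope.
Local Open Scope ring_scope.

(* Totally ordered abelian groups.  A plain record over [porderZmodType], since
   an HB structure with these axioms would have to precede [realDomainType] in
   the hierarchy. *)
Record oagType := OAGroup {
  oag_sort :> porderZmodType;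
  oag_total : forall x y : oag_sort, (x <= y) || (y <= x);
  oag_lerD2l : forall z x y : oag_sort, x <= y -> z + x <= z + y
}.

Definition divisible (G : zmodType) : Prop :=
  forall (n : nat) (x : G), (0 < n)%N -> exists y : G, y *+ n = x.

(* [f] is an isomorphism of the ordered set [(A, ltA)] onto [(B, ltB)]. *)
Definition order_iso (S T : Type) (A : set S) (ltA : S -> S -> Prop)
    (B : set T) (ltB : T -> T -> Prop) (f : S -> T) : Prop :=
  set_bij A B f /\ forall s t, A s -> A t -> (ltA s t <-> ltB (f s) (f t)).

(* The notions below live on [porderZmodType] so that they apply both to an
   [oagType] and to the ordered additive group of a real field. *)

Definition absg (G : porderZmodType) (x : G) : G := Num.max x (- x).

Definition arch_equiv (G : porderZmodType) (x y : G) : Prop :=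
  exists n : nat, absg y <= absg x *+ n /\ absg x <= absg y *+ n.

Definition arch_ll (G : porderZmodType) (x y : G) : Prop :=
  forall n : nat, absg x *+ n < absg y.

(* For [x != 0] this is [x]'s natural valuation; the class of a nonzero element
   contains no zero, so [y] need not be required to be nonzero. *)
Definition arch_class (G : porderZmodType) (x : G) : set G :=
  [set y | arch_equiv x y].

Definition rank (G : porderZmodType) : set (set G) :=
  [set gamma | exists2 x : G, x != 0 & gamma = arch_class x].

(* Larger elements have smaller class: [y] < [x] iff x << y. *)
Definition rank_lt (G : porderZmodType) (gamma delta : set G) : Prop :=
  exists x y : G, [/\ delta x, gamma y & arch_ll x y].

Definition archimedean (G : porderZmodType) (B : {pred G}) : Prop :=
  {in B &, forall x y : G, x != 0 -> y != 0 -> arch_equiv x y}.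

Definition arch_component (G : oagType) (gamma : set G) (B : zmodClosed G) :
    Prop :=
  [/\ exists2 x : G, gamma x & x \in B,
      archimedean B &
      forall B' : zmodClosed G,
        archimedean B' -> {subset B <= B'} -> {subset B' <= B}].

Definition exponential_group_in (G C : oagType) : Prop :=
  (exists h : set G -> G,
     order_iso (@rank G) (@rank_lt G)
       [set g : G | g < 0] (fun g1 g2 : G => g1 < g2) h) /\
  (forall gamma : set G, rank gamma ->
     exists2 B : zmodClosed G, arch_component gamma B &
       exists f : {additive C -> G},
         order_iso [set: C] (fun a b : C => a < b)
           [set x : G | x \in B] (fun x y : G => x < y) f).

Definition exponential_group (G : oagType) : Prop :=
  exists2 C : oagType, archimedean (@predT C) & exponential_group_in G C.

(* The value set [rank K] of the natural valuation, ordered by [rank_lt] and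
   with addition [x] + [y] = [x * y], is isomorphic to [G]. *)
Definition value_group_iso (K : realFieldType) (G : oagType) : Prop :=
  exists f : set K -> G,
    order_iso (@rank K) (@rank_lt K) [set: G] (fun a b : G => a < b) f /\
    forall x y : K, x != 0 -> y != 0 ->
      f (arch_class (x * y)) = f (arch_class x) + f (arch_class y).

(* First-order logic with equality in the language {+, *, 0, 1, <}, with
   named variables. *)
Inductive pa_term : Type :=
  | TVar of nat
  | TZero
  | TOne
  | TAdd of pa_term & pa_term
  | TMul of pa_term & pa_term.

Inductive pa_formula : Type :=
  | FEq of pa_term & pa_term
  | FLt of pa_term & pa_term
  | FNot of pa_formula
  | FAnd of pa_formula & pa_formula
  | FOr of pa_formula & pa_formula
  | FImp of pa_formula & pa_formula
  | FAll of nat & pa_formula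
  | FEx of nat & pa_formula.

Record pa_structure : Type := PAStructure {
  pa_sort :> Type;
  pa_zero : pa_sort;
  pa_one : pa_sort;
  pa_add : pa_sort -> pa_sort -> pa_sort;
  pa_mul : pa_sort -> pa_sort -> pa_sort;
  pa_lt : pa_sort -> pa_sort -> Prop
}.

Definition upd (M : Type) (e : nat -> M) (k : nat) (a : M) : nat -> M :=
  fun i => if i == k then a else e i.

Fixpoint pa_eval (M : pa_structure) (e : nat -> M) (t : pa_term) : M :=
  match t with
  | TVar k => e k
  | TZero => pa_zero M
  | TOne => pa_one M
  | TAdd t1 t2 => pa_add (pa_eval e t1) (pa_eval e t2)
  | TMul t1 t2 => pa_mul (pa_eval e t1) (pa_eval e t2)
  end.

Fixpoint pa_sat (M : pa_structure) (e : nat -> M) (phi : pa_formula) : Prop :=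
  match phi with
  | FEq t1 t2 => pa_eval e t1 = pa_eval e t2
  | FLt t1 t2 => pa_lt (pa_eval e t1) (pa_eval e t2)
  | FNot f => ~ pa_sat e f
  | FAnd f g => pa_sat e f /\ pa_sat e g
  | FOr f g => pa_sat e f \/ pa_sat e g
  | FImp f g => pa_sat e f -> pa_sat e g
  | FAll k f => forall a : M, pa_sat (upd e k a) f
  | FEx k f => exists a : M, pa_sat (upd e k a) f
  end.

(* The universal closure of [phi] holds in [M]. *)
Definition pa_valid (M : pa_structure) (phi : pa_formula) : Prop :=
  forall e : nat -> M, pa_sat e phi.

Definition discretely_ordered (A : realDomainType) (S : {pred A}) : Prop :=
  {in S, forall z : A, 0 < z -> 1 <= z}.

Definition cone_pred (A : realDomainType) (S : subringClosed A) (x : A) : bool :=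
  (x \in S) && (0 <= x).

Definition cone_sort (A : realDomainType) (S : subringClosed A) : Type :=
  {x : A | cone_pred S x}.

Fact cone_pred0 (A : realDomainType) (S : subringClosed A) : cone_pred S 0.
Proof. by rewrite /cone_pred rpred0 lexx. Qed.

Fact cone_pred1 (A : realDomainType) (S : subringClosed A) : cone_pred S 1.
Proof. by rewrite /cone_pred rpred1 ler01. Qed.

Fact cone_predD (A : realDomainType) (S : subringClosed A) (x y : cone_sort S) :
  cone_pred S (sval x + sval y).
Proof.
case: x y => [x /andP[Sx x0]] [y /andP[Sy y0]] /=.
by rewrite /cone_pred rpredD // addr_ge0.
Qed.

Fact cone_predM (A : realDomainType) (S : subringClosed A) (x y : cone_sort S) :
  cone_pred S (sval x * sval y).
Proof.
case: x y => [x /andP[Sx x0]] [y /andP[Sy y0]] /=.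
by rewrite /cone_pred rpredM // mulr_ge0.
Qed.

Definition nonneg_cone (A : realDomainType) (S : subringClosed A) :
    pa_structure :=
  @PAStructure (cone_sort S)
    (exist (cone_pred S) 0 (cone_pred0 S))
    (exist (cone_pred S) 1 (cone_pred1 S))
    (fun x y => exist (cone_pred S) (sval x + sval y) (cone_predD x y))
    (fun x y => exist (cone_pred S) (sval x * sval y) (cone_predM x y))
    (fun x y => sval x < sval y).

Fact predT_subring_closed (A : pzRingType) : subring_closed (@predT A).
Proof. by []. Qed.

Definition full_subring (A : pzRingType) : subringClosed A :=
  HB.pack (@predT A : {pred A})
    (GRing.isSubringClosed.Build A (@predT A) (predT_subring_closed A)).

(* [phi] belongs to the theory of the non-negative cones of discretely ordered
   commutative rings.  A totally ordered commutative ring with [0 < 1] and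
   positive cone closed under products is an integral domain, hence a
   [realDomainType]. *)
Definition discrete_cone_theory (phi : pa_formula) : Prop :=
  forall A : realDomainType, discretely_ordered (full_subring A) ->
    pa_valid (nonneg_cone (full_subring A)) phi.

(* Induction on the variable [k]; the other free variables of [phi] are
   parameters, whose values are given by [e]. *)
Definition pa_induction (M : pa_structure) : Prop :=
  forall (phi : pa_formula) (k : nat) (e : nat -> M),
    pa_sat (upd e k (pa_zero M)) phi ->
    (forall a : M, pa_sat (upd e k a) phi ->
       pa_sat (upd e k (pa_add a (pa_one M))) phi) ->
    forall a : M, pa_sat (upd e k a) phi.

Definition peano_model (M : pa_structure) : Prop :=
  (forall phi, discrete_cone_theory phi -> pa_valid M phi) /\ pa_induction M.

Definition integer_part (R : realFieldType) (Z : subringClosed R) : Prop :=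
  discretely_ordered Z /\
  forall r : R, exists2 z : R, z \in Z & z <= r < z + 1.

(* Main.v *)
From HB Require Import structures.
Require Import Defs.
From mathcomp Require Import all_boot all_order all_algebra.
From mathcomp Require Import boolp classical_sets functions filter realalg.
From mathcomp Require Import ring lra zify.

(* A divisible ordered group G is realized as the value group of a real closed
   field K all of whose residues are algebraic numbers, whereas an integer part
   satisfying induction forces a transcendental residue.

   Construction of K. By Fourier-Motzkin elimination, every finite part of G
   embeds in the integers, so an ultraproduct L of copies of the real algebraic
   numbers contains monomials tau g, multiplicative in g, such that
   tau h is infinitesimal with respect to tau g when g < h. Let K be the
   algebraic closure in L of the field F generated by the monomials. A nonzero
   element of F is q * tau g up to a relative infinitesimal, with q rational.
   In a polynomial equation over F two terms have the same value, so the value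
   group of K is the divisible hull of G; dividing the equation by its largest
   coefficient shows that the residues of K are algebraic.

   Transcendental residue. Put b_0 = 1, b_{k+1} = 4 lcm(1, ..., b_k). Partial
   sums of sum_k 1/b_k provide a p/q with the first-order property that for every
   c < n there is a fraction a/b with c < b < 5 lcm(1, ..., c) such that p/q - a/b
   is between 1/(5 lcm(1, ..., b)) and 1/lcm(1, ..., b), for all standard n,
   hence, by induction in the model, for some nonstandard n. As
   lcm(1, ..., b) grows faster than any power of b, Liouville's argument shows
   that the residue of the resulting p/q is transcendental. *)

Set Implicit Arguments.
Unset Strict Implicit.
Unset Printing Implicit Defensive.

Import Order.TTheory GRing.Theory Num.Theory.
Local Open Scope classical_set_scope.
Local Open Scope ring_scope.

(** * Ultrapowers of real closed fields *)

Section Ultrapower.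
Local Open Scope quotient_scope.
Context (I : Type) (R : rcfType) (U : set_system I).

(* Carrying the proof that [U] is an ultrafilter in the type lets the instances
   below be found by unification. *)
Definition ultra_eq (_ : UltraFilter U) : rel (I -> R) :=
  fun f g => `[< U [set i | f i = g i] >].

Context (UU : UltraFilter U).

Fact ultra_eq_equiv : equiv_class_of (ultra_eq UU).
Proof.
split=> [f|f g|g f h]; rewrite /ultra_eq.
- by apply/asboolP; apply: filterS filterT.
- by apply/asbool_equiv_eq; split; apply: filterS => i.
- by move=> /asboolP fg /asboolP gh; apply/asboolP;
  apply: filterS2 fg gh => i /= -> ->.
Qed.

Canonical ultra_equiv := EquivRelPack ultra_eq_equiv.

Definition ultrapower := {eq_quot ultra_equiv}.
HB.instance Definition _ := Choice.on ultrapower.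
HB.instance Definition _ := EqQuotient.on ultrapower.

Definition ucls (f : I -> R) : ultrapower := \pi f.

Lemma uclsP f g : ucls f = ucls g <-> U [set i | f i = g i].
Proof.
split=> [/eqquotP /asboolP //|fg]; apply/eqquotP.
exact/asboolP.
Qed.

Lemma ucls_repr f : U [set i | repr (ucls f) i = f i].
Proof. by apply/uclsP; rewrite /ucls reprK. Qed.

Lemma uclsW (P : ultrapower -> Prop) : (forall f, P (ucls f)) -> forall x, P x.
Proof. by move=> Pf x; rewrite -[x]reprK; apply: Pf. Qed.

Definition uadd (x y : ultrapower) := ucls (fun i => repr x i + repr y i).
Definition uopp (x : ultrapower) := ucls (fun i => - repr x i).
Definition umul (x y : ultrapower) := ucls (fun i => repr x i * repr y i).
Definition uinv (x : ultrapower) := ucls (fun i => (repr x i)^-1).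
Definition unorm (x : ultrapower) := ucls (fun i => `|repr x i|).
Definition ule (x y : ultrapower) : bool :=
  `[< U [set i | repr x i <= repr y i] >].

Lemma uaddE f g : uadd (ucls f) (ucls g) = ucls (fun i => f i + g i).
Proof.
apply/uclsP; apply: filterS (filterI (ucls_repr f) (ucls_repr g)) => i.
by move=> [/= -> ->].
Qed.

Lemma umulE f g : umul (ucls f) (ucls g) = ucls (fun i => f i * g i).
Proof.
apply/uclsP; apply: filterS (filterI (ucls_repr f) (ucls_repr g)) => i.
by move=> [/= -> ->].
Qed.

Lemma uoppE f : uopp (ucls f) = ucls (fun i => - f i).
Proof. by apply/uclsP; apply: filterS (ucls_repr f) => i /= ->. Qed.

Lemma uinvE f : uinv (ucls f) = ucls (fun i => (f i)^-1).
Proof. by apply/uclsP; apply: filterS (ucls_repr f) => i /= ->. Qed.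

Lemma unormE f : unorm (ucls f) = ucls (fun i => `|f i|).
Proof. by apply/uclsP; apply: filterS (ucls_repr f) => i /= ->. Qed.

Lemma uleE f g : ule (ucls f) (ucls g) <-> U [set i | f i <= g i].
Proof.
split=> [/asboolP le_fg|le_fg].
  apply: filterS (filterI (filterI (ucls_repr f) (ucls_repr g)) le_fg) => i.
  by move=> [[/= -> ->]].
apply/asboolP.
apply: filterS (filterI (filterI (ucls_repr f) (ucls_repr g)) le_fg) => i.
by move=> [[/= -> ->]].
Qed.

Fact uaddA : associative uadd.
Proof.
elim/uclsW=> f; elim/uclsW=> g; elim/uclsW=> h; rewrite !uaddE.
by congr ucls; apply/funext => i; rewrite addrA.
Qed.
Fact uaddC : commutative uadd.
Proof.
elim/uclsW=> f; elim/uclsW=> g; rewrite !uaddE.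
by congr ucls; apply/funext => i; rewrite addrC.
Qed.
Fact uadd0 : left_id (ucls (fun=> 0)) uadd.
Proof.
by elim/uclsW=> f; rewrite !uaddE; congr ucls; apply/funext => i; rewrite add0r.
Qed.
Fact uaddN : left_inverse (ucls (fun=> 0)) uopp uadd.
Proof.
elim/uclsW=> f; rewrite uoppE uaddE.
by congr ucls; apply/funext => i; rewrite addNr.
Qed.
HB.instance Definition _ :=
  GRing.isZmodule.Build ultrapower uaddA uaddC uadd0 uaddN.

Fact umulA : associative umul.
Proof.
elim/uclsW=> f; elim/uclsW=> g; elim/uclsW=> h; rewrite !umulE.
by congr ucls; apply/funext => i; rewrite mulrA.
Qed.
Fact umulC : commutative umul.
Proof.
elim/uclsW=> f; elim/uclsW=> g; rewrite !umulE.
by congr ucls; apply/funext => i; rewrite mulrC.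
Qed.
Fact umul1 : left_id (ucls (fun=> 1)) umul.
Proof.
by elim/uclsW=> f; rewrite !umulE; congr ucls; apply/funext => i; rewrite mul1r.
Qed.
Fact umulD : left_distributive umul uadd.
Proof.
elim/uclsW=> f; elim/uclsW=> g; elim/uclsW=> h; rewrite !(umulE, uaddE).
by congr ucls; apply/funext => i; rewrite mulrDl.
Qed.
Fact uone_neq0 : ucls (fun=> 1) != 0.
Proof.
apply/eqP => /uclsP /filter_ex[i /= /eqP]; by rewrite oner_eq0.
Qed.
HB.instance Definition _ := GRing.Zmodule_isComNzRing.Build ultrapower
  umulA umulC umul1 umulD uone_neq0.

Lemma ucls0 : ucls (fun=> 0) = 0. Proof. by []. Qed.
Lemma ucls1 : ucls (fun=> 1) = 1. Proof. by []. Qed.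
Lemma uclsD f g : ucls (fun i => f i + g i) = ucls f + ucls g.
Proof. by rewrite -uaddE. Qed.
Lemma uclsN f : ucls (fun i => - f i) = - ucls f.
Proof. by rewrite -uoppE. Qed.
Lemma uclsM f g : ucls (fun i => f i * g i) = ucls f * ucls g.
Proof. by rewrite -umulE. Qed.

Lemma ucls_eq0 f : (ucls f == 0) = `[< U [set i | f i = 0] >].
Proof. by apply/eqP/asboolP => /uclsP. Qed.

(** Maximality of the ultrafilter turns failure of almost everywhere vanishing into almost
    everywhere non-vanishing, and so yields inverses. *)
Lemma ucls_neq0 f : ucls f != 0 <-> U [set i | f i != 0].
Proof.
rewrite ucls_eq0; split=> [/asboolPn|Uf].
  case: (in_ultra_setVsetC [set i | f i = 0] UU) => // Uf _.
  by apply: filterS Uf => i /= /eqP.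
apply/asboolPn => Uf'; have [i [/= /eqP fi /fi]] := filter_ex (filterI Uf Uf').
by [].
Qed.

Fact umulV (x : ultrapower) : x != 0 -> uinv x * x = 1.
Proof.
elim/uclsW: x => f /ucls_neq0 f0; rewrite uinvE -uclsM; apply/uclsP.
by apply: filterS f0 => i /= f0; rewrite mulVf.
Qed.
Fact uinv0 : uinv 0 = 0.
Proof.
by rewrite -ucls0 uinvE; congr ucls; apply/funext=> i; rewrite invr0.
Qed.
HB.instance Definition _ := GRing.ComNzRing_isField.Build ultrapower umulV uinv0.

Definition ult (x y : ultrapower) := (y != x) && ule x y.

Fact ule0_add x y : ule 0 x -> ule 0 y -> ule 0 (x + y).
Proof.
elim/uclsW: x => f; elim/uclsW: y => g; rewrite -uclsD -!ucls0.
move=> /uleE f0 /uleE g0; apply/uleE; apply: filterS2 f0 g0 => i.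
exact: addr_ge0.
Qed.
Fact ule0_mul x y : ule 0 x -> ule 0 y -> ule 0 (x * y).
Proof.
elim/uclsW: x => f; elim/uclsW: y => g; rewrite -uclsM -!ucls0.
move=> /uleE f0 /uleE g0; apply/uleE; apply: filterS2 f0 g0 => i.
exact: mulr_ge0.
Qed.
Fact ule0_anti x : ule 0 x -> ule x 0 -> x = 0.
Proof.
elim/uclsW: x => f; rewrite -!ucls0 => /uleE f0 /uleE f0'; apply/uclsP.
by apply: filterS2 f0 f0' => i /= f0 f0'; apply/eqP; rewrite eq_le f0 f0'.
Qed.
Fact usub_ge0 x y : ule 0 (y - x) = ule x y.
Proof.
elim/uclsW: x => f; elim/uclsW: y => g; rewrite -uclsN -uclsD -!ucls0.
apply/idP/idP => /uleE fg; apply/uleE; apply: filterS fg => i /=;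
  by rewrite subr_ge0.
Qed.
Fact ule0_total x : ule 0 x || ule x 0.
Proof.
elim/uclsW: x => f; rewrite -!ucls0.
case: (in_ultra_setVsetC [set i | 0 <= f i] UU) => Uf; apply/orP; [left|right].
  exact/uleE.
by apply/uleE; apply: filterS Uf => i /= /negP; rewrite -ltNge => /ltW.
Qed.
Fact unormN x : unorm (- x) = unorm x.
Proof.
elim/uclsW: x => f; rewrite -uclsN !unormE.
by congr ucls; apply/funext=> i; rewrite normrN.
Qed.
Fact uge0_norm x : ule 0 x -> unorm x = x.
Proof.
elim/uclsW: x => f; rewrite -!ucls0 unormE => /uleE f0; apply/uclsP.
by apply: filterS f0 => i /= /ger0_norm.
Qed.
HB.instance Definition _ := Num.IntegralDomain_isLeReal.Build ultrapower
  ule0_add ule0_mul ule0_anti usub_ge0 ule0_total unormN uge0_norm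
  (fun x y => erefl (ult x y)).

Lemma ucls_le f g : (ucls f <= ucls g) <-> U [set i | f i <= g i].
Proof. exact: uleE. Qed.

Lemma ucls_sum n (F : 'I_n -> I -> R) :
  ucls (fun i => \sum_k F k i) = \sum_k ucls (F k).
Proof.
elim: n F => [|n IH] F.
  rewrite big_ord0 -ucls0; congr ucls.
  by apply/funext => i; rewrite big_ord0.
rewrite big_ord_recl -IH -uclsD; congr ucls.
by apply/funext => i; rewrite big_ord_recl.
Qed.

Lemma uclsX f n : ucls (fun i => f i ^+ n) = ucls f ^+ n.
Proof.
elim: n => [|n IH]; first by rewrite expr0 -ucls1.
rewrite exprS -IH -uclsM; congr ucls.
by apply/funext => i; rewrite exprS.
Qed.

Lemma uclsMn f n : ucls (fun i => f i *+ n) = ucls f *+ n.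
Proof.
elim: n => [|n IH]; first by rewrite mulr0n -ucls0.
rewrite mulrS -IH -uclsD; congr ucls.
by apply/funext => i; rewrite mulrS.
Qed.

(** A case of Los's theorem: representatives of the coefficients turn [p] into a family [P i], and
    roots found coordinate by coordinate form a root of [p]. *)
Fact ultrapower_poly_ivt : Num.real_closed_axiom ultrapower.
Proof.
move=> p a b; elim/uclsW: a => a; elim/uclsW: b => b /ucls_le le_ab.
pose P i : {poly R} := \poly_(k < size p) repr p`_k i.
have hornerP (c : I -> R) : p.[ucls c] = ucls (fun i => (P i).[c i]).
  transitivity (ucls (fun i => \sum_(k < size p) repr p`_k i * c i ^+ k)).
    rewrite horner_coef ucls_sum; apply: eq_bigr => k _.
    by rewrite uclsM uclsX; congr (_ * _); rewrite -[LHS]reprK.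
  congr ucls; apply/funext => i.
  by rewrite horner_poly.
rewrite !hornerP -ucls0 => /andP[/ucls_le pa /ucls_le pb].
pose good i (x : R) := a i <= x <= b i /\ root (P i) x.
have /choice [c Pc] : forall i, exists c,
    a i <= b i -> (P i).[a i] <= 0 -> 0 <= (P i).[b i] -> good i c.
  move=> i;
    have [h|h] := pselect [/\ a i <= b i, (P i).[a i] <= 0 & 0 <= (P i).[b i]].
    case: h => h1 h2 h3.
    have [|c c1 c2] := @poly_ivt R (P i) (a i) (b i) h1; first by rewrite h2.
    by exists c.
  (* Default value at the coordinates that violate the hypotheses; they form a set outside [U]. *)
  by exists 0 => h1 h2 h3; case: h.
have Uc : U [set i | good i (c i)].
  apply: filterS2 le_ab (filterI pa pb) => i ab [pai pbi].
  exact: Pc.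
exists (ucls c).
  by apply/andP; split; apply/ucls_le; apply: filterS Uc => i [/andP[]].
rewrite rootE hornerP; apply/eqP/uclsP; apply: filterS Uc => i [_ /rootP].
by [].
Qed.
HB.instance Definition _ :=
  Num.RealField_isClosed.Build ultrapower ultrapower_poly_ivt.

End Ultrapower.

(** * Local embeddings of ordered groups in the integers *)

Section OrderedGroup.
Context (G : oagType).
Implicit Types x y z u : G.

Lemma oag_lerD z x y : (z + x <= z + y) = (x <= y).
Proof.
apply/idP/idP => [|]; last exact: oag_lerD2l.
by move/(oag_lerD2l (- z)); rewrite !addKr.
Qed.

Lemma oag_ltrD z x y : (z + x < z + y) = (x < y).
Proof. by rewrite !lt_neqAle oag_lerD (inj_eq (addrI z)). Qed.

Lemma oag_subr_gt0 x y : (0 < y - x) = (x < y).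
Proof. by rewrite -[LHS](oag_ltrD x) addr0 addrC subrK. Qed.

Lemma oag_oppr_gt0 x : (0 < - x) = (x < 0).
Proof. by rewrite -[- x]add0r oag_subr_gt0. Qed.

Lemma oag_oppr_lt0 x : (- x < 0) = (0 < x).
Proof. by rewrite -oag_oppr_gt0 opprK. Qed.

Lemma oag_addr_gt0 x y : 0 < x -> 0 < y -> 0 < x + y.
Proof.
by move=> x0 y0; apply: (lt_trans x0); rewrite -{1}[x]addr0 oag_ltrD.
Qed.

Lemma oag_lt_total x y : [\/ x < y, x = y | y < x].
Proof.
have [->|ne] := eqVneq x y; first by constructor 2.
case/orP: (oag_total x y) => le_xy; [constructor 1|constructor 3].
  by rewrite lt_neqAle ne.
by rewrite lt_neqAle eq_sym ne.
Qed.

Lemma oag_mulrn_gt0 x n : 0 < x -> 0 < x *+ n.+1.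
Proof.
move=> x0; elim: n => [|n IH]; first by rewrite mulr1n.
by rewrite mulrSr oag_addr_gt0.
Qed.

Lemma oag_mulrz_gt0 x (c : int) : 0 < x -> 0 < c -> 0 < x *~ c.
Proof. by case: c => // -[//|n] x0 _; rewrite -pmulrn oag_mulrn_gt0. Qed.

Definition same_sign (u : G) (v : rat) : Prop :=
  [\/ 0 < u /\ 0 < v, u = 0 /\ v = 0 | u < 0 /\ v < 0].

Lemma same_signN u v : same_sign u v -> same_sign (- u) (- v).
Proof.
case=> -[]; first by constructor 3; rewrite oag_oppr_lt0 oppr_lt0.
  by move=> -> ->; constructor 2; rewrite !oppr0.
by constructor 1; rewrite oag_oppr_gt0 oppr_gt0.
Qed.

Lemma same_signMz_pos u v (c : int) : 0 < c ->
  same_sign u v -> same_sign (u *~ c) (v *~ c).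
Proof.
move=> c0 [[u0 v0]|[-> ->]|[u0 v0]].
- by constructor 1; split; [apply: oag_mulrz_gt0|rewrite pmulrz_lgt0].
- by constructor 2; rewrite !mul0rz.
- constructor 3; split; last by rewrite pmulrz_llt0.
  by rewrite -oag_oppr_gt0 -mulNrz oag_mulrz_gt0 // oag_oppr_gt0.
Qed.

Lemma same_signMz u v (c : int) :
  same_sign u v -> same_sign (u *~ c) (v *~ c).
Proof.
case: (ltrgtP c 0) => [c0 /same_signN uv|c0|->].
- rewrite -[c]opprK ![_ *~ - (- c)]mulrNz -!mulNrz.
  by apply: same_signMz_pos => //; rewrite oppr_gt0.
- exact: same_signMz_pos.
- by constructor 2; rewrite !mulr0z.
Qed.

(** Multiplying once more by [c] leaves the factor [c * c], which is positive and changes no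
    sign. *)
Lemma same_signMzK u v (c : int) : c != 0 ->
  same_sign (u *~ c) (v *~ c) -> same_sign u v.
Proof.
move=> c0 /same_signMz - /(_ c); rewrite -!mulrzA.
have c2 : 0 < c * c by rewrite -expr2 exprn_even_gt0.
have v0 : (v *~ (c * c) == 0) = (v == 0).
  by rewrite mulrz_eq0 gt_eqF.
have vp : (0 < v *~ (c * c)) = (0 < v) by rewrite pmulrz_lgt0.
have vn : (v *~ (c * c) < 0) = (v < 0) by rewrite pmulrz_llt0.
case: (oag_lt_total u 0) => [u0|->|u0].
- have ucn : u *~ (c * c) < 0.
    by rewrite -oag_oppr_gt0 -mulNrz oag_mulrz_gt0 // oag_oppr_gt0.
  case=> -[]; first by rewrite lt_gtF.
    by move=> E; rewrite E ltxx in ucn.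
  by rewrite vn => _ ?; constructor 3.
- rewrite mul0rz; case=> -[]; rewrite ?ltxx //.
  by move=> _ /eqP; rewrite v0 => /eqP ->; constructor 2.
- have ucp := oag_mulrz_gt0 u0 c2.
  case=> -[]; last by rewrite lt_gtF.
    by rewrite vp => _ ?; constructor 1.
  by move=> E; rewrite E ltxx in ucp.
Qed.

End OrderedGroup.

(** Missing coefficients default to 0 and those past [n] are ignored, so one list [l] is a form in
    any number of variables. *)
Definition zform (V : zmodType) (x : nat -> V) (n : nat) (l : seq int) : V :=
  \sum_(i < n) x i *~ l`_i.

(** When [a] and [b] are the last coefficients of [m] and [l], the last variable cancels. *)
Definition zcomb (n : nat) (a : int) (l : seq int) (b : int) (m : seq int) :=
  mkseq (fun i => l`_i * a - m`_i * b) n.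

Lemma zform_comb (V : zmodType) (x : nat -> V) n a l b m :
  zform x n (zcomb n a l b m) = zform x n l *~ a - zform x n m *~ b.
Proof.
rewrite /zform !mulrz_suml -sumrB; apply: eq_bigr => i _.
by rewrite nth_mkseq // mulrzBr !mulrzA.
Qed.

Lemma zformS (V : zmodType) (x : nat -> V) n l :
  zform x n.+1 l = zform x n l + x n *~ l`_n.
Proof. by rewrite /zform big_ord_recr. Qed.

(** The sets are finite, so density of the rationals suffices, or the absence of endpoints when one
    set is empty. *)
Lemma rat_cut (A B : seq rat) :
  (forall a b, a \in A -> b \in B -> a < b) ->
  exists x, (forall a, a \in A -> a < x) /\ (forall b, b \in B -> x < b).
Proof.
have above (C : seq rat) : exists x, forall c, c \in C -> c < x.
  elim: C => [|c C [x IH]]; first by exists 0.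
  exists (Num.max (c + 1) x) => d; rewrite inE lt_max => /orP[/eqP->|/IH->].
    by rewrite ltrDl ltr01.
  by rewrite orbT.
have below (C : seq rat) : exists x, forall c, c \in C -> x < c.
  have [x Px] := above (map -%R C); exists (- x) => c Cc.
  by rewrite ltrNl Px // map_f.
elim: A => [|a A IH] AB.
  by have [x Px] := below B; exists x.
have [|x [Ax xB]] := IH.
  by move=> a' b Aa'; apply: AB; rewrite inE Aa' orbT.
have [y [ay yB]] : exists y, a < y /\ forall b, b \in B -> y < b.
  elim: B {IH xB} AB => [|b B IH] AB; first by exists (a + 1); rewrite ltrDl.
  have [|y [ay yB]] := IH.
    by move=> a' b' Aa' Bb'; apply: AB; rewrite ?inE ?Bb' ?orbT.
  have ab : a < b by apply: AB; rewrite inE eqxx.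
  exists (Num.min y ((a + b) / 2)); rewrite lt_min ay midf_lt //.
  split=> // b'; rewrite inE gt_min => /orP[/eqP->|/yB->//].
  by rewrite [(_ + _) / 2 < _](midf_lt ab) orbT.
exists (Num.max x y); split=> [a'|b Bb]; last by rewrite gt_max xB ?yB.
rewrite inE lt_max => /orP[/eqP->|/Ax->//].
by rewrite ay orbT.
Qed.

Lemma rat_divzK (x : rat) (c : int) : c != 0 -> x / c%:~R *~ c = x.
Proof. by move=> c0; rewrite -[LHS]mulrzr divfK ?intr_eq0. Qed.

Section LocalEmbedding.
Context (G : oagType).

(* Fourier-Motzkin elimination of the last variable. *)
Lemma sign_realizable_rat (g : nat -> G) n (S : seq (seq int)) :
  exists q : nat -> rat,
    forall l, l \in S -> same_sign (zform g n l) (zform q n l).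
Proof.
elim: n S => [|n IH] S.
  by exists (fun=> 0) => l _; rewrite /zform !big_ord0; constructor 2.
(* The forms of [S] serve when the last coefficient is 0; the combinations compare the constraints
   on the last variable. *)
have [q qP] := IH (S ++ [seq zcomb n m`_n l l`_n m | l <- S, m <- S]).
have qS l : l \in S -> same_sign (zform g n l) (zform q n l).
  by move=> Sl; apply: qP; rewrite mem_cat Sl.
have qSS l m : l \in S -> m \in S ->
    same_sign (zform g n l *~ m`_n - zform g n m *~ l`_n)
              (zform q n l *~ m`_n - zform q n m *~ l`_n).
  move=> Sl Sm; rewrite -!zform_comb; apply: qP.
  by rewrite mem_cat (allpairs_f (fun l m => zcomb n m`_n l l`_n m)) ?orbT.
suff [x xP] : exists x : rat, forall l, l \in S ->
    same_sign (zform g n.+1 l) (zform q n l + x *~ l`_n).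
  exists (fun i => if (i < n)%N then q i else x) => l Sl.
  rewrite [X in same_sign _ X]zformS ltnn.
  rewrite [X in same_sign _ (X + _)](_ : _ = zform q n l); first exact: xP.
  by apply: eq_bigr => i _; rewrite ltn_ord.
have elim_last (V : zmodType) (x : nat -> V) l m :
    zform x n.+1 l *~ m`_n - zform x n.+1 m *~ l`_n
    = zform x n l *~ m`_n - zform x n m *~ l`_n.
  rewrite !zformS !mulrzDl -!mulrzA [l`_n * _]mulrC opprD addrACA subrr.
  by rewrite addr0.
(* A vanishing form in which the last variable occurs determines [x]. Otherwise each form with that
   variable gives a strict bound on [x]. *)
have [[l0 [Sl0 l0n l0g]]|noeq] :=
    pselect (exists l0, [/\ l0 \in S, l0`_n != 0 & zform g n.+1 l0 = 0]).
  exists (- zform q n l0 / (l0`_n)%:~R) => l Sl.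
  apply: (@same_signMzK _ _ _ l0`_n) => //.
  have := qSS _ _ Sl Sl0; rewrite -elim_last l0g mul0rz subr0.
  by congr (same_sign _ _); rewrite mulrzDl mulrzAC rat_divzK // mulNrz.
(* Multiplied by its last coefficient, the form becomes over the rationals a positive multiple of
   [x - alpha l]; so the sign of [u l] tells on which side of [x] to put [alpha l]. *)
pose u l := zform g n.+1 l *~ l`_n.
pose alpha (l : seq int) : rat := - zform q n l / (l`_n)%:~R.
have [|x [Ax xB]] := @rat_cut [seq alpha l | l <- S & (0 < u l) && (l`_n != 0)]
   [seq alpha l | l <- S & (u l < 0) && (l`_n != 0)].
  move=> _ _ /mapP[l + ->] /mapP[m + ->].
  rewrite !mem_filter => /andP[/andP[ul ln] Sl] /andP[/andP[um mn] Sm].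
  (* Multiplied by both last coefficients, the combination of [l] and [m] is positive in [G], hence
     over the rationals, where it is a positive multiple of [alpha m - alpha l]. *)
  have := qSS _ _ Sl Sm;
    rewrite -elim_last => /same_signMz - /(_ (l`_n * m`_n)).
  have -> : (zform g n.+1 l *~ m`_n - zform g n.+1 m *~ l`_n) *~ (l`_n * m`_n)
    = u l *~ (m`_n * m`_n) + - u m *~ (l`_n * l`_n).
    rewrite mulrzBl -!mulrzA mulNrz -!mulrzA; congr (_ *~ _ - _ *~ _); ring.
  have sq (c : int) : c != 0 -> 0 < c * c.
    by move=> c0; rewrite -expr2 exprn_even_gt0.
  have w0 : 0 < u l *~ (m`_n * m`_n) + - u m *~ (l`_n * l`_n).
    by rewrite oag_addr_gt0 // oag_mulrz_gt0 ?sq ?oag_oppr_gt0.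
  case=> -[]; last by rewrite lt_gtF.
    move=> _ H; rewrite -subr_gt0 /alpha.
    have l0 : (l`_n)%:~R != 0 :> rat by rewrite intr_eq0.
    have m0 : (m`_n)%:~R != 0 :> rat by rewrite intr_eq0.
    have -> : - zform q n m / (m`_n)%:~R - - zform q n l / (l`_n)%:~R =
      ((zform q n l *~ m`_n - zform q n m *~ l`_n) *~ (l`_n * m`_n)) /
        ((l`_n * m`_n) ^+ 2)%:~R.
      rewrite -[(_ - _) *~ _]mulrzr -[_ *~ m`_n]mulrzr -[_ *~ l`_n]mulrzr.
      by rewrite rmorphXn !rmorphM /=; field; rewrite ?l0 ?m0.
    by rewrite divr_gt0 // ltr0z exprn_even_gt0 // mulf_neq0.
  by move=> E; rewrite E ltxx in w0.
exists x => l Sl.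
have [ln0|ln] := eqVneq l`_n 0.
  by rewrite zformS ln0 !mulr0z !addr0; apply: qS.
apply: (@same_signMzK _ _ _ l`_n) => //.
have lnQ : (l`_n)%:~R != 0 :> rat by rewrite intr_eq0.
have -> : (zform q n l + x *~ l`_n) *~ l`_n
   = (x - alpha l) * ((l`_n) ^+ 2)%:~R.
  rewrite -[LHS]mulrzr -[x *~ _]mulrzr /alpha.
  by rewrite rmorphXn /=; field.
have sq : 0 < ((l`_n) ^+ 2)%:~R :> rat by rewrite ltr0z exprn_even_gt0.
case: (oag_lt_total (u l) 0) => ul.
- constructor 3; split=> //; rewrite pmulr_llt0 // subr_lt0.
  by apply: xB; apply: map_f; rewrite mem_filter ul ln.
- case: noeq; exists l; split=> //.
  have : same_sign (zform g n.+1 l) 0.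
    by apply: (same_signMzK ln); rewrite -/(u l) ul mul0rz; constructor 2.
  by case=> -[]; rewrite ?ltxx.
- constructor 1; split=> //; rewrite pmulr_lgt0 // subr_gt0.
  by apply: Ax; apply: map_f; rewrite mem_filter ul ln.
Qed.

(** Multiplying a rational solution by the product [D] of its denominators changes no sign. *)
Lemma sign_realizable_int (g : nat -> G) n (S : seq (seq int)) :
  exists z : nat -> int,
    forall l, l \in S -> same_sign (zform g n l) (zform z n l)%:~R.
Proof.
have [q qP] := sign_realizable_rat g n S.
pose D := \prod_(i < n) denq (q i).
have D0 : 0 < D%:~R :> rat.
  by rewrite ltr0z; apply: prodr_gt0 => i _; apply: denq_gt0.
have /choice[z zP] : forall i, exists z : int, (i < n)%N -> z%:~R = q i * D%:~R.
  move=> i; case: (ltnP i n) => [lt_in|]; last by exists 0.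
  exists (numq (q i) * \prod_(j < n | j != Ordinal lt_in) denq (q j)) => _.
  have -> : D = denq (q i) * \prod_(j < n | j != Ordinal lt_in) denq (q j).
    by rewrite /D (bigD1 (Ordinal lt_in)).
  rewrite !intrM mulrA; congr (_ * _).
  by rewrite numqE.
exists z => l /qP qgl.
have -> : (zform z n l)%:~R = zform q n l * D%:~R.
  rewrite /zform rmorph_sum mulr_suml; apply: eq_bigr => i _ /=.
  by rewrite mulrzz intrM zP ?ltn_ord // -[q i *~ _]mulrzr mulrAC.
case: qgl => -[g0 q0]; [constructor 1|constructor 2|constructor 3]; split=> //.
- by rewrite pmulr_lgt0.
- by rewrite q0 mul0r.
- by rewrite pmulr_llt0.
Qed.

Lemma zform_mkseq (V : zmodType) (x : nat -> V) n (f : nat -> int) :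
  zform x n (mkseq f n) = \sum_(i < n) x i *~ f i.
Proof. by apply: eq_bigr => i _; rewrite nth_mkseq. Qed.

Lemma sum_mulrz_delta (V : zmodType) (x : nat -> V) n j : (j < n)%N ->
  \sum_(i < n) x i *~ ((i == j :> nat)%:R : int) = x j.
Proof.
move=> jn; rewrite (bigD1 (Ordinal jn)) //= eqxx mulr1z big1 ?addr0 //.
by move=> i /negPf; rewrite -val_eqE /= => ->; rewrite mulr0z.
Qed.

(** Sums and order within [s] are signs of the finitely many forms [fadd] and [fsub] in the entries
    of [s], so an integer solution with the same signs preserves them. *)
Lemma local_int_embedding (s : seq G) :
  exists psi : G -> int,
    (forall g h, g \in s -> h \in s -> g + h \in s ->
       psi (g + h) = psi g + psi h) /\
    (forall g h, g \in s -> h \in s -> g < h -> psi g < psi h).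
Proof.
pose n := size s; pose x i := nth 0 s i;
  pose e (i j : nat) : int := (i == j)%:R.
pose fadd (t : nat * nat * nat) :=
  mkseq (fun i => e i t.1.1 + e i t.1.2 - e i t.2) n.
pose fsub (t : nat * nat) := mkseq (fun i => e i t.1 - e i t.2) n.
pose r := iota 0 n.
have [z zP] := sign_realizable_int x n
  ([seq fadd t | t <- [seq (a, b) | a <- [seq (c, d) | c <- r, d <- r], b <- r]]
   ++ [seq fsub t | t <- [seq (c, d) | c <- r, d <- r]]).
have idx g : g \in s -> (index g s < n)%N by rewrite index_mem.
have idxr g : g \in s -> index g s \in r by move=> sg;
  rewrite mem_iota add0n idx.
have zfadd (V : zmodType) (y : nat -> V) i j k : (i < n)%N -> (j < n)%N ->
    (k < n)%N -> zform y n (fadd (i, j, k)) = y i + y j - y k.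
  move=> ilt jlt klt; rewrite zform_mkseq.
  rewrite -[y i](@sum_mulrz_delta V y n) // -[y j](@sum_mulrz_delta V y n) //.
  rewrite -[y k](@sum_mulrz_delta V y n) // -big_split -sumrB /=.
  by apply: eq_bigr => l _; rewrite mulrzBr mulrzDr.
have zfsub (V : zmodType) (y : nat -> V) i j : (i < n)%N -> (j < n)%N ->
    zform y n (fsub (i, j)) = y i - y j.
  move=> ilt jlt; rewrite zform_mkseq.
  rewrite -[y i](@sum_mulrz_delta V y n) // -[y j](@sum_mulrz_delta V y n) //.
  by rewrite -sumrB; apply: eq_bigr => l _; rewrite mulrzBr.
exists (fun g => z (index g s)); split=> g h sg sh; last move=> gh.
  move=> sgh.
  have : same_sign (x (index g s) + x (index h s) - x (index (g + h) s))
     (z (index g s) + z (index h s) - z (index (g + h) s))%:~R.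
    rewrite -!zfadd ?idx //; apply: zP; rewrite mem_cat map_f //.
    by rewrite !allpairs_f ?idxr.
  rewrite /x !nth_index // subrr => -[] []; rewrite ?ltxx // => _ /eqP.
  by rewrite intr_eq0 subr_eq0 => /eqP.
have : same_sign (x (index h s) - x (index g s))
     (z (index h s) - z (index g s))%:~R.
  rewrite -!zfsub ?idx //; apply: zP; rewrite mem_cat orbC map_f //.
  by rewrite !allpairs_f ?idxr.
have hg : 0 < h - g by rewrite oag_subr_gt0.
rewrite /x !nth_index // => -[] [].
- by rewrite ltr0z subr_gt0.
- by move=> E; rewrite E ltxx in hg.
- by rewrite lt_gtF.
Qed.

End LocalEmbedding.

(** * Monomials *)

(** The order is reversed to match [rank_lt], for which smaller elements have larger classes. *)
Definition monomial_map (G : oagType) (L : realFieldType) (tau : G -> L) : Prop :=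
  [/\ forall g, 0 < tau g,
      forall g h, tau (g + h) = tau g * tau h &
      forall g h, g < h -> forall n, tau h *+ n < tau g].

Lemma exists_monomial_map (G : oagType) :
  exists (L : rcfType) (tau : G -> L), monomial_map tau.
Proof.
have /choice [psi psiP] := @local_int_embedding G.
(* An index is a finite part of [G] with a natural number. The ultrafilter will contain every cone
   [B i], so each finite requirement holds almost everywhere. *)
pose I := (seq G * nat)%type.
pose B (i : I) := [set j : I | {subset i.1 <= j.1} /\ (i.2 <= j.2)%N].
have BP : ProperFilter (filter_from setT B).
  apply: filter_from_proper; last by move=> i _; exists i; split.
  apply: filter_from_filter; first by exists ([::], 0%N).
  move=> i j _ _; exists (i.1 ++ j.1, maxn i.2 j.2) => // k [/= sk nk].
  rewrite geq_max in nk; case/andP: nk => n1 n2.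
  split; split=> // g sg; apply: sk; rewrite mem_cat sg ?orbT //.
have [U [UU BU]] := ultraFilterLemma BP.
have BUP (s : seq G) n (P : set I) :
    (forall i, {subset s <= i.1} -> (n <= i.2)%N -> P i) -> U P.
  by move=> sP; apply: BU; exists (s, n) => // i [/= ? ?]; apply: sP.
(* The base exceeds any given natural number almost everywhere, so a difference of one unit in [psi]
   outweighs every standard multiple. *)
pose t g : I -> realalg := fun i => i.2.+2%:R ^ (- psi i.1 g).
have t0 g i : 0 < t g i by rewrite exprz_gt0.
have tgt g h : g < h -> forall n, (ucls UU (t h)) *+ n <= ucls UU (t g).
  move=> gh n; rewrite -uclsMn; apply/ucls_le; apply: (BUP [:: g;
    h] n) => i si ni.
  have lt_psi : psi i.1 g < psi i.1 h.
    by apply: (psiP i.1).2 => //; apply: si; rewrite !inE eqxx ?orbT.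
  rewrite /=.
  have -> : t g i = t h i * i.2.+2%:R ^ (psi i.1 h - psi i.1 g).
    by rewrite /t -expfzDr ?pnatr_eq0 //; congr (_ ^ _);
      rewrite addrA addNr add0r.
  rewrite -[_ *+ n]mulr_natr ler_pM2l //.
  case: (psi i.1 h - psi i.1 g) (subr_gt0 (psi i.1 g) (psi i.1 h)) => [k|k];
    rewrite lt_psi // ltz_nat => k0.
  rewrite -exprnP -natrX ler_nat (leq_trans ni) // -(prednK k0) expnS.
  rewrite (leq_trans (leq_trans (leqnSn _) (leqnSn _))) //.
  by rewrite leq_pmulr // expn_gt0.
have tau0 g : 0 < ucls UU (t g).
  rewrite lt_neqAle eq_sym; apply/andP; split.
    by apply/ucls_neq0; apply: (BUP [::] 0) => i _ _; rewrite /= gt_eqF.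
  by rewrite -ucls0; apply/ucls_le; apply: (BUP [::] 0) => i _ _;
    rewrite /= ltW.
exists (ultrapower realalg UU), (fun g => ucls UU (t g)); split=> //.
- move=> g h; rewrite -uclsM; apply/uclsP.
  apply: (BUP [:: g; h; g + h] 0) => i si _ /=.
  rewrite /t (psiP i.1).1 ?opprD ?expfzDr ?pnatr_eq0 //; apply: si;
    by rewrite !inE eqxx ?orbT.
- move=> g h gh n; apply: lt_le_trans (tgt g h gh n.+1).
  by rewrite mulrS ltrDr.
Qed.

(** * Subfields *)

Section Subfield.
Context (E : fieldType) (S : divringClosed E).
Record subfield := Subfield { subfield_val :> E; _ : subfield_val \in S }.
HB.instance Definition _ := [isSub for subfield_val].
HB.instance Definition _ := [Choice of subfield by <:].
HB.instance Definition _ := [SubChoice_isSubUnitRing of subfield by <:].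
HB.instance Definition _ := [SubNzRing_isSubComNzRing of subfield by <:].
HB.instance Definition _ := [SubComUnitRing_isSubIntegralDomain of subfield by <:].
HB.instance Definition _ := [SubIntegralDomain_isSubField of subfield by <:].
End Subfield.

Section RealSubfield.
Context (E : realFieldType) (S : divringClosed E).
Local Notation T := (subfield S).
Implicit Types x y : T.

Let le x y := val x <= val y.
Let norm x : T := if 0 <= val x then x else - x.

Fact subfield_le0_add x y : le 0 x -> le 0 y -> le 0 (x + y).
Proof. by rewrite /le raddf0 raddfD; apply: addr_ge0. Qed.
Fact subfield_le0_mul x y : le 0 x -> le 0 y -> le 0 (x * y).
Proof. by rewrite /le raddf0 rmorphM; apply: mulr_ge0. Qed.
Fact subfield_le0_anti x : le 0 x -> le x 0 -> x = 0.
Proof. by move=> x0 x0'; apply/val_inj/le_anti/andP; split. Qed.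
Fact subfield_sub_ge0 x y : le 0 (y - x) = le x y.
Proof. by rewrite /le raddf0 raddfB subr_ge0. Qed.
Fact subfield_le0_total x : le 0 x || le x 0.
Proof. exact: le_total. Qed.
Fact subfield_normN x : norm (- x) = norm x.
Proof.
rewrite /norm raddfN oppr_ge0 opprK.
case: ltrgtP => // x0; apply: val_inj.
by rewrite raddfN x0 oppr0; apply: esym.
Qed.
Fact subfield_ge0_norm x : le 0 x -> norm x = x.
Proof. by rewrite /le raddf0 /norm => ->. Qed.

HB.instance Definition _ := Num.IntegralDomain_isLeReal.Build T
  subfield_le0_add subfield_le0_mul subfield_le0_anti subfield_sub_ge0
  subfield_le0_total subfield_normN subfield_ge0_norm
  (fun x y => erefl ((y != x) && le x y)).

Lemma subfield_leE x y : (x <= y) = (val x <= val y). Proof. by []. Qed.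

End RealSubfield.

(** The intermediate value root exists in [L] and lies in [S] by hypothesis; for the zero polynomial
    an endpoint serves. *)
Lemma real_closed_subfield (L : rcfType) (S : divringClosed L) :
    (forall (p : {poly L}) x, p \is a polyOver S -> p != 0 -> root p x ->
       x \in S) ->
  exists (K : rcfType) (iota : {rmorphism K -> L}),
    {mono iota : x y / x <= y} /\ (forall y, y \in S <-> exists x, y = iota x).
Proof.
move=> Scl; pose T := subfield S.
have Tivt : Num.real_closed_axiom T.
  move=> p a b ab; rewrite !subfield_leE raddf0 => pab.
  have vh (c : T) : val p.[c] = (map_poly val p).[val c] by rewrite horner_map.
  have [p0|p0] := eqVneq p 0.
    by exists a; rewrite ?lexx // p0 rootE horner0.
  have [] := @poly_ivt L (map_poly val p) (val a) (val b);
    rewrite ?subfield_leE -?vh //.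
  move=> c cab rc.
  have Sc : c \in S.
    apply: Scl rc; last by rewrite map_poly_eq0.
    by apply/polyOverP => i; rewrite coef_map; apply: valP.
  exists (Sub c Sc); first by rewrite !subfield_leE.
  by apply/eqP/val_inj; rewrite vh; exact: (rootP rc).
pose K : rcfType := HB.pack T (Num.RealField_isClosed.Build T Tivt).
exists K, (val : {rmorphism subfield S -> L}); split=> // y; split.
  by move=> Sy; exists (Sub y Sy).
by case=> x ->; apply: valP.
Qed.

(** * Infinitesimals and Archimedean equivalence *)

Section Valuation.
Context (E : realFieldType).
Implicit Types x y z : E.

Definition infinitesimal x : Prop := forall n : nat, `|x| *+ n < 1.
Definition bounded x : Prop := exists n : nat, `|x| <= n%:R.

Lemma infinitesimal0 : infinitesimal 0.
Proof. by move=> n; rewrite normr0 mul0rn ltr01. Qed.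

Lemma infinitesimal_le x y : `|x| <= `|y| -> infinitesimal y -> infinitesimal x.
Proof.
by move=> xy y0 n; apply: le_lt_trans (y0 n); rewrite lerMn2r xy orbT.
Qed.

Lemma infinitesimalN x : infinitesimal x -> infinitesimal (- x).
Proof. by apply: infinitesimal_le; rewrite normrN. Qed.

Lemma infinitesimalD x y :
  infinitesimal x -> infinitesimal y -> infinitesimal (x + y).
Proof.
move=> x0 y0 n.
have := x0 (n + n)%N; have := y0 (n + n)%N.
rewrite !mulrnDr => h1 h2.
apply: (@le_lt_trans _ _ (`|x| *+ n + `|y| *+ n)).
  by rewrite -mulrnDl lerMn2r ler_normD orbT.
lra.
Qed.

Lemma infinitesimalB x y :
  infinitesimal x -> infinitesimal y -> infinitesimal (x - y).
Proof. by move=> x0 /infinitesimalN; apply: infinitesimalD. Qed.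

Lemma infinitesimalM x y : infinitesimal x -> bounded y -> infinitesimal (x * y).
Proof.
move=> x0 [m ym] n; apply: le_lt_trans (x0 (m * n)%N).
by rewrite normrM mulrnA lerMn2r -[`|x| *+ m]mulr_natr ler_wpM2l ?orbT.
Qed.

Lemma infinitesimal_sum (I : Type) (r : seq I) (F : I -> E) :
  (forall i, infinitesimal (F i)) -> infinitesimal (\sum_(i <- r) F i).
Proof.
by move=> F0; elim/big_ind: _ => //;
  [apply: infinitesimal0 | apply: infinitesimalD].
Qed.

Lemma bounded_nat n : bounded n%:R.
Proof. by exists n; rewrite ger0_norm. Qed.

Lemma boundedD x y : bounded x -> bounded y -> bounded (x + y).
Proof.
move=> [n xn] [m ym]; exists (n + m)%N; rewrite natrD.
exact: le_trans (ler_normD _ _) (lerD xn ym).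
Qed.

Lemma boundedM x y : bounded x -> bounded y -> bounded (x * y).
Proof.
by move=> [n xn] [m ym]; exists (n * m)%N; rewrite natrM normrM ler_pM.
Qed.

Lemma boundedX x n : bounded x -> bounded (x ^+ n).
Proof.
move=> xb; elim: n => [|n IH]; first exact: (bounded_nat 1).
by rewrite exprS; apply: boundedM.
Qed.

Lemma bounded_ratr q : bounded (ratr q).
Proof.
exists (Num.truncn `|q|).+1; rewrite -ratr_norm -ratr_nat ler_rat ltW //.
exact: Num.Theory.truncnS_gt.
Qed.

Lemma infinitesimal_bounded x : infinitesimal x -> bounded x.
Proof. by move=> /(_ 1%N); exists 1%N; rewrite ltW. Qed.

Lemma infinitesimal_ratr q : infinitesimal (ratr q) -> q = 0.
Proof.
move=> q0; apply/eqP/negPn/negP => qn0.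
have := q0 (Num.truncn `|q|^-1).+1; apply/negP; rewrite -leNgt.
rewrite -ratr_norm -mulr_natr -ratr_nat -rmorphM -[1](rmorph1 ratr) ler_rat.
rewrite -ler_pdivrMl ?normr_gt0 // mulr1 ltW //.
exact: Num.Theory.truncnS_gt.
Qed.

Lemma bounded_inv x : ~ infinitesimal x -> bounded x^-1.
Proof.
move=> /existsNP[n /negP]; rewrite -leNgt => xn; exists n.
have x0 : 0 < `|x|.
  by rewrite normr_gt0; apply/eqP => x0; move: xn;
    rewrite x0 normr0 mul0rn ler10.
by rewrite normfV -[_^-1]mulr1 ler_pdivrMl // mulr_natr.
Qed.

(** Archimedean equivalence in multiplicative form, for nonzero elements. As division by 0 gives 0,
    every element is [asym] to 0, whence the condition in [asym_trans]. *)
Definition asym x y : Prop := bounded (x / y) /\ bounded (y / x).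

Lemma asymC x y : asym x y -> asym y x. Proof. by case. Qed.

Lemma asym_trans y x z : y != 0 -> asym x y -> asym y z -> asym x z.
Proof.
move=> y0 [xy yx] [yz zy]; split.
  by rewrite -[x](divfK y0) -[_ * _ / _]mulrA; apply: boundedM.
by rewrite -[z](divfK y0) -[_ * _ / _]mulrA; apply: boundedM.
Qed.

Lemma asymM x y z t : asym x y -> asym z t -> asym (x * z) (y * t).
Proof.
by move=> [? ?] [? ?]; split; rewrite invfM mulrACA; apply: boundedM.
Qed.

Lemma asymV x y : asym x y -> asym x^-1 y^-1.
Proof. by move=> [? ?]; split; rewrite invrK mulrC. Qed.

Lemma asym_refl x : asym x x.
Proof.
have [->|x0] := eqVneq x 0; first by split; rewrite mul0r; apply: (bounded_nat 0).
by split; rewrite divff //; apply: (bounded_nat 1).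
Qed.

Lemma bounded_root x n : (0 < n)%N -> bounded (x ^+ n) -> bounded x.
Proof.
case: n => // n _ [m xm]; exists m.+1; rewrite leNgt; apply/negP => mx.
have x1 : 1 <= `|x| by apply: ltW; apply: le_lt_trans mx; rewrite ler1n.
have : `|x| <= m%:R.
  apply: le_trans xm; rewrite normrX exprS ler_peMr //.
  by rewrite exprn_ege1.
by rewrite leNgt (le_lt_trans _ mx) // ler_nat.
Qed.

Lemma asym_root x y n : (0 < n)%N -> asym (x ^+ n) (y ^+ n) -> asym x y.
Proof. by move=> n0 [xy yx]; split; apply: bounded_root n0 _;
  rewrite expr_div_n. Qed.

(** The largest term is minus the sum of the others, hence at most [n] times the second largest. *)
Lemma asym_of_sum_eq0 n (t : 'I_n -> E) i0 : t i0 != 0 -> \sum_i t i = 0 ->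
  exists i j, [/\ i != j, t i != 0, t j != 0 & asym (t i) (t j)].
Proof.
move=> ti0 t0; pose i := [arg max_(i > i0) `|t i|]%O.
have imax j : `|t j| <= `|t i|.
  by rewrite /i; case: Order.TotalTheory.arg_maxP => // k _; apply.
have tin0 : t i != 0 by rewrite -normr_gt0 (lt_le_trans _ (imax i0)) ?normr_gt0.
have [j0 ij0] : exists j0, j0 != i.
  apply/existsP; apply: contraNT tin0 => /existsPn none.
  rewrite -t0 (bigD1 i) //= big1 ?addr0 // => j.
  by rewrite (negPf (none j)).
pose j := [arg max_(j > j0 | j != i) `|t j|]%O.
have [ji jmax] : j != i /\ forall k, k != i -> `|t k| <= `|t j|.
  by rewrite /j; case: Order.TotalTheory.arg_maxP.
have tij : `|t i| <= `|t j| *+ n.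
  have -> : t i = - \sum_(k | k != i) t k.
    by apply/eqP; rewrite -addr_eq0; move: t0; rewrite (bigD1 i) //= => ->.
  rewrite normrN (le_trans (ler_norm_sum _ _ _)) //.
  apply: (@le_trans _ _ (\sum_(k < n | k != i) `|t j|)); first exact: ler_sum.
  rewrite sumr_const ler_wpMn2l //.
  by rewrite -[X in (_ <= X)%N](card_ord n) max_card.
have tjn0 : t j != 0.
  apply: contraNneq tin0 => tj; move: tij; rewrite tj normr0 mul0rn.
  by rewrite normr_le0.
exists i, j; split=> //; first by rewrite eq_sym.
split; [exists n|exists 1%N]; rewrite normrM normfV ler_pdivrMr ?normr_gt0 //.
  by rewrite mulr_natl.
by rewrite mul1r.
Qed.

End Valuation.

(** * The field of algebraic elements over the monomials *)

Section MonomialMap.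
Context (G : oagType) (L : realFieldType) (tau : G -> L).
Context (tauP : monomial_map tau).
Implicit Types (x y : L) (g h : G).

Lemma monomial_gt0 g : 0 < tau g. Proof. by case: tauP. Qed.

Lemma monomial_neq0 g : tau g != 0. Proof. by rewrite gt_eqF ?monomial_gt0. Qed.

Lemma monomialD g h : tau (g + h) = tau g * tau h. Proof. by case: tauP. Qed.

Lemma monomial0 : tau 0 = 1.
Proof. by apply: (mulfI (monomial_neq0 0)); rewrite -monomialD addr0 mulr1. Qed.

Lemma monomialN g : tau (- g) = (tau g)^-1.
Proof.
by apply: (mulfI (monomial_neq0 g));
  rewrite -monomialD subrr monomial0 divff ?monomial_neq0.
Qed.

Lemma monomialB g h : tau (g - h) = tau g / tau h.
Proof. by rewrite monomialD monomialN. Qed.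

Lemma monomialMn g n : tau (g *+ n) = tau g ^+ n.
Proof.
by elim: n => [|n IH]; rewrite ?monomial0 // mulrS exprS monomialD IH.
Qed.

Lemma infinitesimal_monomial g : 0 < g -> infinitesimal (tau g).
Proof.
case: tauP => _ _ ll g0 n; rewrite gtr0_norm ?monomial_gt0 //.
by rewrite -monomial0; apply: ll.
Qed.

(** Rationality of the leading coefficient is what makes the residues of [monomial_field]
    rational. *)
Definition has_lead x : Prop :=
  exists q g, q != 0 /\ infinitesimal (x / tau g - ratr q).

Lemma bounded_near x q : infinitesimal (x - ratr q) -> bounded x.
Proof.
move=> x0; rewrite -[x](subrK (ratr q)).
by apply: boundedD (infinitesimal_bounded x0) (bounded_ratr _ _).
Qed.

Lemma has_leadM x y : has_lead x -> has_lead y -> has_lead (x * y).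
Proof.
move=> [q [g [q0 xq]]] [r [h [r0 yr]]]; exists (q * r), (g + h).
split; first by rewrite mulf_neq0.
rewrite monomialD invfM mulrACA rmorphM.
have -> : x / tau g * (y / tau h) - ratr q * ratr r
   = (x / tau g - ratr q) * (y / tau h) + (y / tau h - ratr r) * ratr q by ring.
apply: infinitesimalD; apply: infinitesimalM => //.
  exact: bounded_near yr.
exact: bounded_ratr.
Qed.

Lemma has_leadV x : has_lead x -> has_lead x^-1.
Proof.
move=> [q [g [q0 xq]]]; exists q^-1, (- g); split; first by rewrite invr_eq0.
rewrite monomialN -invfM fmorphV; set a := x / tau g in xq *.
have an : ~ infinitesimal a.
  move=> a0; case/eqP: q0; apply: (@infinitesimal_ratr L).
  by rewrite -[ratr q](subKr a); apply: infinitesimalB.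
have a0 : a != 0.
  by apply/eqP => a0; apply: an; rewrite a0; apply: infinitesimal0.
have qL0 : ratr q != 0 :> L by rewrite fmorph_eq0.
have -> : a^-1 - (ratr q)^-1 = - (a - ratr q) * (a^-1 * (ratr q)^-1).
  by field; rewrite ?a0 ?qL0.
apply: infinitesimalM; first exact: infinitesimalN.
apply: boundedM; first exact: bounded_inv.
by rewrite -fmorphV; apply: bounded_ratr.
Qed.

Lemma has_lead_asym x : has_lead x -> exists g, asym x (tau g).
Proof.
move=> [q [g [q0 xq]]]; exists g; split; first exact: bounded_near xq.
rewrite -invf_div; apply: bounded_inv => a0; case/eqP: q0.
by apply: (@infinitesimal_ratr L); rewrite -[ratr q](subKr (x / tau g));
  apply: infinitesimalB.
Qed.

(** A negative leading exponent would make the coefficient [q] infinitesimal; exponent 0 gives the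
    residue [q], a positive one the residue 0. *)
Lemma bounded_lead x : has_lead x -> bounded x ->
  exists q, infinitesimal (x - ratr q).
Proof.
move=> [q [g [q0 xq]]] xb; case: (oag_lt_total g 0) => [g0|g0|g0].
- exfalso; case/eqP: q0; apply: (@infinitesimal_ratr L).
  rewrite -[ratr q](subKr (x / tau g)); apply: infinitesimalB => //.
  rewrite mulrC; apply: infinitesimalM xb; rewrite -monomialN.
  by apply: infinitesimal_monomial; rewrite oag_oppr_gt0.
- by exists q; move: xq; rewrite g0 monomial0 divr1.
- exists 0; rewrite rmorph0 subr0 -[x](divfK (monomial_neq0 g)) mulrC.
  apply: infinitesimalM; first exact: infinitesimal_monomial.
  exact: bounded_near xq.
Qed.

(** The image in [L] of the rational group ring of [G]; exponents may repeat in the list. *)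
Definition monomial_sum x : Prop :=
  exists s : seq (rat * G), x = \sum_(t <- s) ratr t.1 * tau t.2.

Lemma monomial_sumM x y :
  monomial_sum x -> monomial_sum y -> monomial_sum (x * y).
Proof.
move=> [s ->] [r ->].
exists [seq (w.1.1 * w.2.1, w.1.2 + w.2.2) | w <- [seq (t, u) | t <- s, u <- r]].
rewrite big_map big_allpairs mulr_suml; apply: eq_bigr => t _.
rewrite mulr_sumr; apply: eq_bigr => u _ /=.
by rewrite monomialD rmorphM mulrACA.
Qed.

Lemma monomial_sumB x y :
  monomial_sum x -> monomial_sum y -> monomial_sum (x - y).
Proof.
move=> [s ->] [r ->].
exists (s ++ [seq (- u.1, u.2) | u <- r]).
rewrite big_cat big_map -sumrN; congr (_ + _); apply: eq_bigr => u _ /=.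
by rewrite rmorphN mulNr.
Qed.

Lemma monomial_sum_tau g : monomial_sum (tau g).
Proof. by exists [:: (1, g)]; rewrite big_seq1 rmorph1 mul1r. Qed.

(** Collect the terms of least exponent [g0]. If their coefficients cancel, drop them and induct on
    the length; otherwise they dominate all the others. *)
Lemma monomial_sum_lead x : monomial_sum x -> x != 0 -> has_lead x.
Proof.
move=> [s ->]; have [n] := ubnP (size s); elim: n s => // n IH s sn x0.
have [g0 [sg0 g0min]] : exists g0, g0 \in [seq t.2 | t <- s] /\
    forall t, t \in s -> g0 <= t.2.
  case: s x0 {IH sn} => [|t s _]; first by rewrite big_nil eqxx.
  elim: s t => [|u s IH] t.
    by exists t.2; rewrite inE eqxx; split=> // v; rewrite inE => /eqP ->.
  have [g [sg gmin]] := IH u.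
  case/orP: (oag_total t.2 g) => tg; [exists t.2|exists g].
    rewrite inE eqxx; split=> // v; rewrite inE => /orP[/eqP->//|sv].
    exact: le_trans tg (gmin _ sv).
  rewrite inE sg orbT; split=> // v; rewrite inE => /orP[/eqP->//|].
  exact: gmin.
pose c := \sum_(t <- s | t.2 == g0) t.1.
pose y : L := \sum_(t <- s | t.2 != g0) ratr t.1 * tau t.2.
have xE : \sum_(t <- s) ratr t.1 * tau t.2 = ratr c * tau g0 + y.
  rewrite (bigID (fun t => t.2 == g0)) /= rmorph_sum mulr_suml; congr (_ + _).
  by apply: eq_bigr => t /eqP ->.
have [c0|c0] := eqVneq c 0.
  move: x0; rewrite xE c0 rmorph0 mul0r add0r /y -big_filter; apply: IH.
  rewrite -ltnS (leq_trans _ sn) // ltnS size_filter.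
  move: (count_predC (fun t => t.2 == g0) s) => <-.
  rewrite -[ltnLHS]add0n ltn_add2r -has_count.
  by case/mapP: sg0 => t st ->; apply/hasP; exists t.
exists c, g0; split=> //; rewrite xE mulrDl mulfK ?monomial_neq0 // addrC addKr.
rewrite /y big_seq_cond big_mkcond mulr_suml.
apply: infinitesimal_sum => t; case: ifP => [/andP[st tg]|_]; last first.
  by rewrite mul0r; apply: infinitesimal0.
rewrite -mulrA -monomialB mulrC; apply: infinitesimalM;
  last exact: bounded_ratr.
apply: infinitesimal_monomial; rewrite oag_subr_gt0 lt_neqAle eq_sym tg.
exact: g0min.
Qed.

Definition monomial_field : {pred L} := fun x =>
  `[< exists a b, [/\ monomial_sum a, monomial_sum b & x = a / b] >].

Fact monomial_field_closed : divring_closed monomial_field.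
Proof.
have ms1 : monomial_sum 1 by rewrite -monomial0; apply: monomial_sum_tau.
have ms0 : monomial_sum 0 by exists [::]; rewrite big_nil.
split.
- by apply/asboolP; exists 1, 1; rewrite divr1.
(* A quotient by 0 is 0 and can be rewritten as [0 / 1]. *)
- have nz x : monomial_field x -> exists a b,
      [/\ monomial_sum a, monomial_sum b, b != 0 & x = a / b].
    move=> /asboolP[a [b [aS bS ->]]].
    have [->|b0] := eqVneq b 0; last by exists a, b.
    by exists 0, 1; rewrite invr0 mulr0 mul0r oner_eq0.
  move=> x y /nz[a [b [aS bS b0 ->]]] /nz[c [d [cS dS d0 ->]]]; apply/asboolP.
  exists (a * d - c * b), (b * d); split; last by field; rewrite ?b0 ?d0.
    by apply: monomial_sumB; apply: monomial_sumM.
  exact: monomial_sumM.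
- move=> x y /asboolP[a [b [aS bS ->]]] /asboolP[c [d [cS dS ->]]].
  apply/asboolP; exists (a * d), (b * c); split; try exact: monomial_sumM.
  by rewrite !invfM invrK [c^-1 * d]mulrC mulrACA.
Qed.
HB.instance Definition _ :=
  GRing.isDivringClosed.Build L monomial_field monomial_field_closed.

Lemma monomial_field_lead x : x \in monomial_field -> x != 0 -> has_lead x.
Proof.
move=> /asboolP[a [b [aS bS ->]]]; rewrite mulf_eq0 invr_eq0 negb_or.
move=> /andP[a0 b0]; apply: has_leadM; first exact: monomial_sum_lead.
by apply: has_leadV; apply: monomial_sum_lead.
Qed.

Lemma monomial_field_tau g : tau g \in monomial_field.
Proof.
apply/asboolP; exists (tau g), 1; rewrite divr1; split=> //.
  exact: monomial_sum_tau.
by rewrite -monomial0; apply: monomial_sum_tau.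
Qed.

(** Two terms of [p.[x] = 0] are equivalent, so a positive power of [x] is equivalent to a quotient
    of coefficients, hence to a monomial; divisibility of [G] extracts the root. *)
Lemma algebraic_asym (p : {poly L}) x : divisible G ->
    p \is a polyOver monomial_field -> p != 0 -> root p x -> x != 0 ->
  exists g, asym x (tau g).
Proof.
move=> divG /polyOverP pF p0 /rootP; rewrite horner_coef => px x0.
have szp : (0 < size p)%N by rewrite size_poly_gt0.
have lt_last : ((size p).-1 < size p)%N by rewrite prednK.
have [||i [j [ij ti tj tij]]] :=
  @asym_of_sum_eq0 L (size p) (fun i => p`_i * x ^+ i) (Ordinal lt_last) => //.
  by rewrite mulf_neq0 ?expf_neq0 //= lead_coef_eq0.
wlog lt_ij : i j ij ti tj tij / (i < j)%N => [wl|].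
  case: (ltngtP i j) => [lt_ij|lt_ij|/val_inj eq_ij].
  - exact: (wl i j).
  - by apply: (wl j i) => //; [rewrite eq_sym|apply: asymC].
  - by rewrite eq_ij eqxx in ij.
move: ti tj; rewrite !mulf_eq0 !negb_or => /andP[pi0 xi0] /andP[pj0 xj0].
have [g pig] := has_lead_asym (monomial_field_lead (pF i) pi0).
have [h pjh] := has_lead_asym (monomial_field_lead (pF j) pj0).
have n0 : (0 < j - i)%N by rewrite subn_gt0.
have [k kE] := divG _ (g - h) n0; exists k; apply: (asym_root n0).
rewrite -monomialMn kE monomialB.
apply: (@asym_trans _ (p`_i / p`_j)); first by rewrite mulf_neq0 ?invr_eq0.
  have := asymM (asymC tij) (asym_refl ((p`_j)^-1 * (x ^+ i)^-1)).
  have -> : p`_j * x ^+ j * ((p`_j)^-1 * (x ^+ i)^-1) = x ^+ (j - i).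
    rewrite -[in x ^+ j](subnK (ltnW lt_ij)) exprD.
    by field; rewrite ?pj0 ?xi0.
  have -> // : p`_i * x ^+ i * ((p`_j)^-1 * (x ^+ i)^-1) = p`_i / p`_j.
  by field; rewrite ?pj0 ?xi0.
exact: asymM pig (asymV pjh).
Qed.

(** Divided by the largest one, the coefficients are bounded and have rational residues, one of them
    1. These form [f], whose value at [x] differs infinitesimally from 0. *)
Lemma algebraic_residue (p : {poly L}) x :
    p \is a polyOver monomial_field -> p != 0 -> root p x -> bounded x ->
  exists2 f : {poly rat}, f != 0 & infinitesimal (map_poly ratr f).[x].
Proof.
move=> /polyOverP pF p0 /rootP px xb.
have szp : (0 < size p)%N by rewrite size_poly_gt0.
have lt_last : ((size p).-1 < size p)%N by rewrite prednK.
pose i0 := [arg max_(i > Ordinal lt_last) `|p`_i|]%O.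
have i0max (j : 'I_(size p)) : `|p`_j| <= `|p`_i0|.
  by rewrite /i0; case: Order.TotalTheory.arg_maxP => // k _; apply.
have pi0 : p`_i0 != 0.
  rewrite -normr_gt0 (lt_le_trans _ (i0max (Ordinal lt_last))) //.
  by rewrite normr_gt0 lead_coef_eq0.
have /choice[q qP] : forall i, exists q : rat,
    (i < size p)%N -> infinitesimal (p`_i / p`_i0 - ratr q).
  move=> i; case: (ltnP i (size p)) => [ip|]; last by exists 0.
  have [->|pi] := eqVneq p`_i 0.
    by exists 0 => _; rewrite mul0r rmorph0 subrr; apply: infinitesimal0.
  have [||r rP] := @bounded_lead (p`_i / p`_i0).
  - apply: monomial_field_lead; first exact: rpred_div.
    by rewrite mulf_neq0 ?invr_eq0.
  - exists 1%N; rewrite normrM normfV ler_pdivrMr ?normr_gt0 // mul1r.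
    exact: (i0max (Ordinal ip)).
  - by exists r.
exists (\poly_(i < size p) q i).
  apply/eqP => /polyP /(_ i0); rewrite coef_poly ltn_ord coef0 => qi0.
  have := qP i0 (ltn_ord i0); rewrite qi0 rmorph0 subr0 divff // => /(_ 1%N).
  by rewrite normr1 ltxx.
have -> : (map_poly ratr (\poly_(i < size p) q i)).[x]
    = \sum_(i < size p) (ratr (q i) - p`_i / p`_i0) * x ^+ i.
  rewrite (@horner_coef_wide _ (size p)); last first.
    by rewrite size_map_poly size_poly.
  transitivity (\sum_(i < size p) ratr (q i) * x ^+ i -
                \sum_(i < size p) p`_i * x ^+ i / p`_i0).
    rewrite -mulr_suml -horner_coef px mul0r subr0.
    by apply: eq_bigr => i _; rewrite coef_map coef_poly ltn_ord.
  by rewrite -sumrB; apply: eq_bigr => i _; rewrite mulrBl [p`_i * _ / _]mulrAC.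
apply: infinitesimal_sum => i; apply: infinitesimalM; last exact: boundedX.
by rewrite -opprB; apply: infinitesimalN; apply: qP.
Qed.

End MonomialMap.

(** The elements of [L] algebraic over [S] form a field, and by transitivity of integrality it
    contains all roots in [L] of its nonzero polynomials. *)
Lemma rel_algebraic_closure (L : rcfType) (S : divringClosed L) :
  exists (K : rcfType) (iota : {rmorphism K -> L}),
    [/\ {mono iota : x y / x <= y},
        forall y, y \in S -> exists x, y = iota x &
        forall x, exists p, [/\ p \is a polyOver S, p != 0 & root p (iota x)]].
Proof.
pose emb : {rmorphism subfield S -> L} := val.
pose A : {pred L} := fun x => `[< algebraicOver emb x >].
have Aclosed : divring_closed A.
  split; first by apply/asboolP; apply: algebraic1.
    by move=> x y /asboolP Ax /asboolP Ay; apply/asboolP; apply: algebraic_sub.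
  by move=> x y /asboolP Ax /asboolP Ay; apply/asboolP; apply: algebraic_div.
pose A' : divringClosed L := HB.pack A (GRing.isDivringClosed.Build L A Aclosed).
have [p x /polyOverP pA p0 px|K [iota [iota_le iotaP]]] :=
  @real_closed_subfield L A'.
  apply/asboolP/integral_algebraic; apply: (integral_root p0 px).
  by move=> _ /(nthP 0)[i _ <-]; apply/integral_algebraic;
    have /asboolP := pA i.
exists K, iota; split=> // [y Sy|x].
  apply/iotaP; apply/asboolP.
  by have := algebraic_id emb (Subfield Sy).
have /asboolP[p p0 px] : iota x \in A' by apply/iotaP; exists x.
exists (map_poly emb p); split=> //; last by rewrite map_poly_eq0.
by apply/polyOverP => i; rewrite coef_map; apply: (valP p`_i).
Qed.

(** Being bounded or infinitesimal is expressed by inequalities with natural multiples, which [iota]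
    preserves and reflects, so the facts proved in [L] descend to [K]. *)
Lemma exists_monomial_field (G : oagType) : divisible G ->
  exists (K : rcfType) (tau : G -> K),
    [/\ monomial_map tau,
        forall x, x != 0 -> exists g, asym x (tau g) &
        forall x, bounded x ->
          exists2 f : {poly rat}, f != 0 & @infinitesimal K (map_poly ratr f).[x]].
Proof.
move=> divG; have [L [t tP]] := exists_monomial_map G.
have [K [iota [iota_le iotaF iotaA]]] := rel_algebraic_closure (monomial_field t).
have iota_lt : {mono iota : x y / x < y} by apply: leW_mono.
have iota_norm x : iota `|x| = `|iota x|.
  case: (ger0P x) => x0; rewrite ?rmorphN;
    [rewrite ger0_norm|rewrite ltr0_norm] => //.
    by rewrite -(rmorph0 iota) iota_le.
  by rewrite -(rmorph0 iota) iota_lt.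
have iota_bounded x : bounded x <-> bounded (iota x).
  by split=> -[n xn]; exists n; move: xn;
    rewrite -iota_norm -(rmorph_nat iota) iota_le.
have iota_inf x : infinitesimal x <-> infinitesimal (iota x).
  by split=> xn n; move: (xn n);
    rewrite -iota_norm -rmorphMn -(rmorph1 iota) iota_lt.
have /choice[tau tauE] : forall g, exists x, t g = iota x.
  by move=> g; apply: iotaF; apply: monomial_field_tau.
exists K, tau; split.
- have [t0 tD tll] := tP; split.
  + by move=> g; rewrite -iota_lt rmorph0 -tauE.
  + by move=> g h; apply: (fmorph_inj iota); rewrite rmorphM -!tauE.
  + by move=> g h gh n; rewrite -iota_lt rmorphMn -!tauE; apply: tll.
- move=> x x0; have [p [pF p0 px]] := iotaA x.
  have [|g [xg gx]] := algebraic_asym tP divG pF p0 px;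
    first by rewrite fmorph_eq0.
  by exists g; split; apply/iota_bounded; rewrite fmorph_div -tauE.
- move=> x /iota_bounded xb; have [p [pF p0 px]] := iotaA x.
  have [f f0 fx] := algebraic_residue tP pF p0 px xb; exists f => //.
  apply/iota_inf; rewrite -horner_map -map_poly_comp.
  rewrite (eq_map_poly (g := ratr)) // => q /=.
  exact: fmorph_rat.
Qed.

(** * The value group *)

Lemma absg_norm (E : realFieldType) (x : E) : absg x = `|x|.
Proof. by rewrite /absg -maxrN maxC. Qed.

Lemma arch_equivP (E : realFieldType) (x y : E) :
  x != 0 -> y != 0 -> arch_equiv x y <-> asym x y.
Proof.
rewrite /arch_equiv !absg_norm => x0 y0.
have bnd (a b : E) n : b != 0 -> (`|a / b| <= n%:R) = (`|a| <= `|b| *+ n).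
  by move=> b0; rewrite normrM normfV ler_pdivrMr ?normr_gt0 // mulr_natl.
split=> [[n [yx xy]]|[[n xy] [m yx]]].
  by split; exists n; rewrite bnd.
have le_max (a b : E) k l : (k <= l)%N -> `|a| <= `|b| *+ k -> `|a| <= `|b| *+ l.
  by move=> kl ab; apply: le_trans ab _; rewrite ler_wpMn2l.
exists (maxn n m); rewrite bnd // in xy; rewrite bnd // in yx; split.
  by apply: le_max yx; apply: leq_maxr.
by apply: le_max xy; apply: leq_maxl.
Qed.

Lemma arch_equiv_neq0 (E : realFieldType) (x y : E) :
  x != 0 -> arch_equiv x y -> y != 0.
Proof.
move=> x0 [n []]; rewrite !absg_norm => _; apply: contraTneq => ->.
by rewrite normr0 mul0rn normr_le0.
Qed.

Lemma arch_classP (E : realFieldType) (x y : E) :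
  x != 0 -> y != 0 -> arch_class x = arch_class y <-> asym x y.
Proof.
move=> x0 y0; split=> [xy|xy].
  apply/(arch_equivP x0 y0); have : arch_class y y.
    by apply/(arch_equivP y0 y0); apply: asym_refl.
  by rewrite -xy.
apply/funext => z; apply/propext; rewrite /arch_class /=.
have [->|z0] := eqVneq z 0.
  by split=> /arch_equiv_neq0 -/(_ _)/eqP; [move=> /(_ x0)|move=> /(_ y0)].
split=> [/(arch_equivP x0 z0) xz|/(arch_equivP y0 z0) yz].
  by apply/(arch_equivP y0 z0); apply: asym_trans (asymC xy) xz.
by apply/(arch_equivP x0 z0); apply: asym_trans xy yz.
Qed.

Section ValueGroup.
Context (G : oagType) (K : realFieldType) (tau : G -> K).
Context (tauP : monomial_map tau).
Context (tau_asym : forall x, x != 0 -> exists g, asym x (tau g)).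

Lemma bounded_monomial_le g h : bounded (tau g / tau h) -> h <= g.
Proof.
move=> [n gh]; case: (oag_lt_total h g) => [/ltW //|->//|g_lt_h].
case: tauP => t0 _ /(_ _ _ g_lt_h n); rewrite ltNge => /negP[].
by move: gh; rewrite gtr0_norm ?divr_gt0 // ler_pdivrMr // mulr_natl.
Qed.

Lemma monomial_asym_inj g h : asym (tau g) (tau h) -> g = h.
Proof.
by move=> [gh hg]; apply/le_anti; rewrite !bounded_monomial_le.
Qed.

(** Each class contains exactly one monomial, and [f] reads off its exponent; sets that are not
    classes get the value 0. *)
Lemma monomial_value_group : value_group_iso K G.
Proof.
have t0 := monomial_neq0 tauP.
have /choice[f fP] : forall gamma : set K, exists g,
    rank gamma -> gamma = arch_class (tau g).
  move=> gamma; have [[x x0 ->]|nr] := pselect (rank gamma); last by exists 0.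
  by have [g xg] := tau_asym x0; exists g => _; apply/arch_classP.
have f_class x g : x != 0 -> asym x (tau g) -> f (arch_class x) = g.
  move=> x0 xg; apply: monomial_asym_inj; apply/arch_classP => //.
  rewrite -fP; last by exists x.
  exact/arch_classP.
have f_tau g : f (arch_class (tau g)) = g by apply: f_class (asym_refl _).
exists f; split; first split; first split=> //.
- by move=> gamma delta /[!inE] /fP gE /fP dE ffE; rewrite gE dE ffE.
- move=> g _; exists (arch_class (tau g)) => //.
  by exists (tau g).
- move=> gamma delta rg rd; rewrite {1}(fP _ rg) {1}(fP _ rd).
  set g := f gamma; set h := f delta; split.
    move=> [x [y [hx gy ll]]].
    have x0 := arch_equiv_neq0 (t0 h) hx; have y0 := arch_equiv_neq0 (t0 g) gy.
    move/(arch_equivP (t0 h) x0): hx => hx;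
      move/(arch_equivP (t0 g) y0): gy => gy.
    (* For [h <= g] this quotient is 1 or infinitesimal, so unboundedness forces [g < h]. *)
    suff gh_unb : ~ bounded (tau g / tau h).
      case: (oag_lt_total g h) => // [gh|hg]; case: gh_unb.
        by rewrite gh; case: (asym_refl (tau h)).
      apply: infinitesimal_bounded; rewrite -(monomialB tauP).
      by apply: (infinitesimal_monomial tauP); rewrite oag_subr_gt0.
    move=> gh; have [n] : bounded (y / x).
      have -> : y / x = (y / tau g) * (tau g / tau h) * (tau h / x).
        by field; rewrite x0 !t0.
      by apply: boundedM hx.1; apply: boundedM gh; case: gy.
    rewrite normrM normfV ler_pdivrMr ?normr_gt0 // mulr_natl leNgt => /negP[].
    by have := ll n; rewrite !absg_norm.
  move=> gh; exists (tau h), (tau g); split; try exact/arch_equivP/asym_refl.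
  move=> n; rewrite !absg_norm !gtr0_norm; try exact: (monomial_gt0 tauP).
  by case: tauP => _ _; apply.
- move=> x y x0 y0; have [g xg] := tau_asym x0; have [h yh] := tau_asym y0.
  rewrite (f_class x g) // (f_class y h) //; apply: f_class;
    first by rewrite mulf_neq0.
  by rewrite (monomialD tauP); apply: asymM.
Qed.
End ValueGroup.

(** * Sparse Liouville approximants *)

Section LcmGrowth.
Local Open Scope nat_scope.

(** A function of superpolynomial growth that is definable from divisibility alone, without coding
    sequences in arithmetic; see [F_lcm]. *)
Definition lcm_upto (n : nat) : nat := \big[lcmn/1]_(1 <= i < n.+1) i.

Lemma dvdn_lcm_upto i n : 0 < i <= n -> i %| lcm_upto n.
Proof.
move=> /andP[i0 le_in]; rewrite /lcm_upto (big_cat_nat (n := i)) //=;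
  last exact: leqW.
rewrite [\big[_/_]_(i <= _ < _) _]big_ltn //.
exact: dvdn_trans (dvdn_lcml _ _) (dvdn_lcmr _ _).
Qed.

Lemma lcm_upto_dvdn n m : (forall i, 0 < i <= n -> i %| m) -> lcm_upto n %| m.
Proof.
move=> dv; rewrite /lcm_upto big_seq; elim/big_ind: _ => // [x y xm ym|i].
  by rewrite dvdn_lcm xm.
by rewrite mem_index_iota => /dv.
Qed.

Lemma lcm_upto_gt0 n : 0 < lcm_upto n.
Proof.
rewrite /lcm_upto big_seq; elim/big_ind: _ => // [x y x0 y0|i].
  by rewrite lcmn_gt0 x0.
by rewrite mem_index_iota => /andP[].
Qed.

Lemma leq_lcm_upto m n : m <= n -> lcm_upto m <= lcm_upto n.
Proof.
move=> le_mn; apply: dvdn_leq; first exact: lcm_upto_gt0.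
apply: lcm_upto_dvdn => i /andP[i0 im].
by rewrite dvdn_lcm_upto // i0 (leq_trans im).
Qed.

(* The largest powers up to [b] of [k] distinct primes multiply to a divisor of
   [lcm_upto b] that is at least [b ^ k] up to a constant. *)
Lemma lcm_upto_superpoly k :
  exists2 C, 0 < C & forall b, 0 < b -> b ^ k <= C * lcm_upto b.
Proof.
suff [D [C [C0 CP]]] : exists D C, 0 < C /\ forall b, 0 < b -> exists d,
    [/\ d %| lcm_upto b, forall q, prime q -> q %| d -> q <= D & b ^ k <= C * d].
  exists C => // b b0; have [d [db _ bd]] := CP b b0.
  by rewrite (leq_trans bd) // leq_mul2l dvdn_leq ?lcm_upto_gt0 ?orbT.
elim: k => [|k [D [C [C0 IH]]]].
  exists 1, 1; split=> // b b0; exists 1; split=> // q _ /dvdn_leq; exact.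
(* [D] bounds the primes used so far, so the powers of [p] are coprime to [d]. *)
have [p Dp p_pr] := prime_above D.
exists p, (p * C); split; first by rewrite muln_gt0 prime_gt0.
move=> b b0; have [d [db dD bd]] := IH b b0.
pose t := trunc_log p b.
have pt : p ^ t <= b by apply: trunc_logP => //; apply: prime_gt1.
have bpt : b < p ^ t.+1 by apply: trunc_log_ltn; apply: prime_gt1.
exists (d * p ^ t); split.
- rewrite Gauss_dvd ?db ?dvdn_lcm_upto ?expn_gt0 ?prime_gt0 //.
  rewrite coprime_sym coprimeXl // prime_coprime //.
  by apply/negP => /(dD p p_pr); rewrite leqNgt Dp.
- move=> q q_pr; rewrite Euclid_dvdM // => /orP[/(dD q q_pr) qD|].
    exact: leq_trans qD (ltnW Dp).
  by rewrite Euclid_dvdX // dvdn_prime2 // => /andP[/eqP ->].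
- have -> : p * C * (d * p ^ t) = p ^ t.+1 * (C * d) by rewrite expnS; ring.
  by rewrite expnS leq_mul // ltnW.
Qed.

(** Here [x] is p/q and [s] is a/b; multiplying by [q * b] removes the fractions, which the language
    of arithmetic lacks. *)
Lemma clear_denominators (y p q a b : nat) (x s : rat) : 0 < q -> 0 < b ->
    (p%:R = x * q%:R -> a%:R = s * b%:R ->
    (y%:R * x < y%:R * s + 1 -> (y * p * b < y * q * a + q * b)%N) /\
    (5 * y%:R * s + 1 < 5 * y%:R * x ->
       (5 * (y * q * a) + q * b < 5 * (y * p * b))%N))%R.
Proof.
move=> q0 b0 pE aE; have qb : (0 < q%:R * b%:R :> rat)%R.
  by rewrite -natrM ltr0n muln_gt0 q0.
split=> h; rewrite -(ltr_nat rat) !natrD !natrM pE aE -subr_gt0.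
  have -> : (y%:R * q%:R * (s * b%:R) + q%:R * b%:R - y%:R * (x * q%:R) * b%:R
    = (y%:R * s + 1 - y%:R * x) * (q%:R * b%:R) :> rat)%R by ring.
  by rewrite mulr_gt0 // subr_gt0.
rewrite [X in (0 < X)%R](_ : _ =
  (5 * y%:R * x - (5 * y%:R * s + 1)) * (q%:R * b%:R))%R; last by ring.
by rewrite mulr_gt0 // subr_gt0.
Qed.

End LcmGrowth.

(** * Partial sums of a sparse series of reciprocals *)

Section LiouvilleApproximants.
Local Open Scope nat_scope.

(** With [y = lcm_upto (sparse k)], the factor 4 puts the sum of the later reciprocals between
    1/(4y) and 1/(2y), strictly inside the window from 1/(5y) to 1/y. *)
Fixpoint sparse (k : nat) : nat :=
  if k is k'.+1 then 4 * lcm_upto (sparse k') else 1.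

Lemma sparse_gt0 k : 0 < sparse k.
Proof. by case: k => //= k; rewrite muln_gt0 lcm_upto_gt0. Qed.

Lemma dvdn_sparse k : 4 * sparse k %| sparse k.+1.
Proof. by rewrite /= dvdn_pmul2l // dvdn_lcm_upto // sparse_gt0 leqnn. Qed.

Lemma leq_sparse k : 4 * sparse k <= sparse k.+1.
Proof. exact: dvdn_leq (sparse_gt0 _) (dvdn_sparse _). Qed.

Lemma ltn_sparse k : k < sparse k.
Proof.
elim: k => // k IH; apply: leq_trans (leq_sparse k).
have := sparse_gt0 k; lia.
Qed.

Local Open Scope ring_scope.

Let r (k : nat) : rat := \sum_(j < k) (sparse j.+1)%:R^-1.

Let spQ0 k : 0 < (sparse k)%:R :> rat. Proof. by rewrite ltr0n sparse_gt0. Qed.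

(** Each [sparse j] divides the next one, so the last is a common denominator. *)
Lemma sparse_sumP k : exists a : nat, r k = a%:R / (sparse k)%:R.
Proof.
elim: k => [|k [a ra]]; first by exists 0%N; rewrite /r big_ord0 mul0r.
have /dvdnP[m mE] : (sparse k %| sparse k.+1)%N.
  by apply: dvdn_trans (dvdn_sparse k); apply: dvdn_mull.
exists (a * m + 1)%N; rewrite /r big_ord_recr /= -/(r k) ra.
rewrite -[(4 * lcm_upto _)%N]/(sparse k.+1).
have sk := spQ0 k; have := spQ0 k.+1; rewrite mE natrM natrD natrM => sk1.
have m0 : m%:R != 0 :> rat by apply: contraTneq sk1 => ->; rewrite mul0r ltxx.
by field; rewrite m0 gt_eqF.
Qed.

(** The extra reciprocal on the left carries the induction: twice the next reciprocal is at most the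
    present one. *)
Lemma sparse_sum_upper k K : (k < K)%N ->
  r K + (sparse K)%:R^-1 <= r k + 2 / (sparse k.+1)%:R.
Proof.
elim: K => // K IH; rewrite ltnS leq_eqVlt => /orP[/eqP->|kK].
  by rewrite /r big_ord_recr /= mulrDl !mul1r addrA lexx.
apply: le_trans (IH kK); rewrite {1}/r big_ord_recr /= -/(r K) -addrA lerD2l.
rewrite -[(4 * lcm_upto _)%N]/(sparse K.+1).
have h : 4 * (sparse K)%:R <= (sparse K.+1)%:R :> rat.
  by rewrite -natrM ler_nat leq_sparse.
have := spQ0 K; set u := _%:R => u0; rewrite -/u in h.
have v0 := spQ0 K.+1; set v := _%:R in v0 h *.
rewrite -[_ + _](_ : 2 / v = _); last by rewrite -mulr2n -[RHS]mulr_natl.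
by rewrite ler_pdivrMr // mulrC ler_pdivlMr //; lra.
Qed.

Lemma sparse_sum_lower k K : (k < K)%N -> r k + (sparse k.+1)%:R^-1 <= r K.
Proof.
elim: K => // K IH; rewrite ltnS leq_eqVlt => /orP[/eqP->|kK].
  by rewrite {2}/r big_ord_recr.
apply: le_trans (IH kK) _; rewrite {2}/r big_ord_recr /= lerDl.
by rewrite invr_ge0 ler0n.
Qed.

(* Natural-number form of [1 < 5 y (p/q - a/b)] and [y (p/q - a/b) < 1]
   for [y = lcm_upto b]. *)
Lemma liouville_approximants n : exists p q : nat,
  [/\ 0 < q, p < q + q & forall c, 0 < c -> c < n -> exists b a,
    [/\ c < b, b < 5 * lcm_upto c,
      lcm_upto b * p * b < lcm_upto b * q * a + q * b &
      5 * (lcm_upto b * q * a) + q * b < 5 * (lcm_upto b * p * b)]]%N.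
Proof.
(* The partial sum is long enough to contain a further term beyond the approximant chosen for any
   [c < n]. *)
have [p pE] := sparse_sumP n.+2; exists p, (sparse n.+2).
have [q0] := (sparse_gt0 n.+2); have qQ := spQ0 n.+2.
have pE' : p%:R = r n.+2 * (sparse n.+2)%:R :> rat.
  by rewrite pE divfK // gt_eqF.
split=> //.
  rewrite -(ltr_nat rat) natrD pE' -subr_gt0.
  have -> : (sparse n.+2)%:R + (sparse n.+2)%:R - r n.+2 * (sparse n.+2)%:R
    = (2 - r n.+2) * (sparse n.+2)%:R :> rat by ring.
  rewrite mulr_gt0 // subr_gt0.
  have := @sparse_sum_upper 0 n.+2 isT; rewrite /r big_ord0 add0r.
  rewrite -/(r n.+2); have : 0 < (sparse n.+2)%:R^-1 :> rat by rewrite invr_gt0.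
  have -> : (sparse 1)%:R = 4 :> rat by rewrite /= /lcm_upto big_nat1 muln1.
  by lra.
move=> c c0 cn.
(* Then [b = sparse k.+1] exceeds [c] and is at most [4 * lcm_upto c]. *)
have [k /andP[kc ck]] : exists k, (sparse k <= c < sparse k.+1)%N.
  have ex : exists k, (c < sparse k)%N by exists c; apply: ltn_sparse.
  case: (ex_minnP ex) => -[|k] ck kmin; first by move: ck c0; rewrite ltnS;
    case: c {cn ex kmin}.
  exists k; rewrite ck andbT leqNgt; apply/negP => /kmin.
  by rewrite ltnn.
have kn : (k.+1 < n.+2)%N.
  by have := ltn_sparse k; lia.
have [a aE] := sparse_sumP k.+1; have bQ := spQ0 k.+1.
exists (sparse k.+1), a; split=> //.
  rewrite /= (@leq_ltn_trans (4 * lcm_upto c)%N) ?leq_mul2l ?leq_lcm_upto //.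
  by rewrite ltn_mul2r lcm_upto_gt0.
all: set y := lcm_upto (sparse k.+1).
all: have y0 : 0 < y%:R :> rat by rewrite ltr0n lcm_upto_gt0.
all: have b2 : (sparse k.+2)%:R = 4 * y%:R :> rat by rewrite /y -natrM.
all: have aE' : a%:R = r k.+1 * (sparse k.+1)%:R :> rat by rewrite aE divfK // gt_eqF.
all: have [clear1 clear2] := clear_denominators y q0 (sparse_gt0 k.+1) pE' aE'.
- apply: clear1.
  have h : r n.+2 < r k.+1 + y%:R^-1.
    have := sparse_sum_upper kn.
    have : 0 < (sparse n.+2)%:R^-1 :> rat by rewrite invr_gt0.
    rewrite b2 invfM; have : 0 < y%:R^-1 :> rat by rewrite invr_gt0.
    by lra.
  by move: h; rewrite -(ltr_pM2l y0) mulrDr mulfV ?gt_eqF.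
- apply: clear2; have := sparse_sum_lower kn; rewrite b2 -lerBrDl => h.
  have : 1 < 5 * y%:R * (r n.+2 - r k.+1).
    apply: (@lt_le_trans _ _ (5 * y%:R * (4 * y%:R)^-1)).
      by rewrite invfM mulrACA mulfV ?gt_eqF // mulr1; lra.
    by rewrite ler_pM2l // mulr_gt0.
  by lra.
Qed.
End LiouvilleApproximants.

(** * Liouville's argument modulo infinitesimals *)

Section Liouville.
Context (K : realFieldType).
Implicit Types (x : K) (a b : nat).

Lemma ratr_frac a b : ratr (a%:R / b%:R) = a%:R / b%:R :> K.
Proof.
have -> : ratr (a%:R / b%:R) = ratr a%:R / ratr b%:R :> K by exact: fmorph_div.
by rewrite !ratr_nat.
Qed.

(** Multiplied by this power of [b], the value becomes a nonzero integer. *)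
Lemma int_poly_frac_ge (F : {poly int}) a b : (0 < b)%N ->
    (map_poly intr F).[a%:R / b%:R : K] != 0 ->
  1 <= `|(map_poly intr F).[a%:R / b%:R : K]| * b%:R ^+ size F.
Proof.
move=> b0; set y := _.[_] => y0;
  have bK : b%:R != 0 :> K by rewrite pnatr_eq0 -lt0n.
have [m mE] : exists m : int, y * b%:R ^+ size F = m%:~R.
  exists (\sum_(i < size F) F`_i * (a%:Z ^+ i * b%:Z ^+ (size F - i))).
  rewrite /y (@horner_coef_wide _ (size F)) ?size_poly // mulr_suml rmorph_sum.
  apply: eq_bigr => i _; rewrite coef_map !rmorphM !rmorphXn /= -mulrA;
    congr (_ * _).
  have -> : b%:R ^+ size F = b%:R ^+ i * b%:R ^+ (size F - i) :> K.
    by rewrite -exprD subnKC // ltnW.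
  by rewrite expr_div_n mulrA divfK // expf_neq0.
rewrite -[b%:R]ger0_norm ?ler0n // -normrX -normrM mE -intr_norm ler1z.
rewrite -gtz0_ge1 normr_gt0 -(intr_eq0 K) -mE mulf_neq0 ?expf_neq0 //.
Qed.

Lemma poly_lipschitz (F : {poly int}) : exists B : nat, forall x (z : K),
  `|x| <= 2 -> `|z| <= 2 ->
  `|(map_poly intr F).[x] - (map_poly intr F).[z]| <= B%:R * `|x - z|.
Proof.
(* The difference of [i]-th powers is [x - z] times a sum of [i] products, each of modulus at most
   [2 ^ i]. *)
exists (\sum_(i < size F) `|(F`_i)%R| * (i * 2 ^ i))%N => x z x2 z2.
rewrite !(@horner_coef_wide _ (size F)) ?size_poly // -sumrB natr_sum mulr_suml.
apply: le_trans (ler_norm_sum _ _ _) _; apply: ler_sum => i _.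
rewrite coef_map -mulrBr normrM natrM -mulrA ler_pM //.
  by rewrite /= -intr_norm -pmulrn natr_absz.
rewrite subrXX normrM mulrC ler_wpM2r //.
apply: le_trans (ler_norm_sum _ _ _) _.
apply: (@le_trans _ _ (\sum_(j < i) 2 ^+ i)); last first.
  by rewrite sumr_const card_ord natrM natrX mulr_natl.
apply: ler_sum => j _; rewrite normrM !normrX.
have -> : 2 ^+ i = 2 ^+ (i.-1 - j) * 2 ^+ j.+1 :> K.
  by rewrite -exprD; congr (_ ^+ _); have := ltn_ord j; lia.
apply: ler_pM; rewrite ?exprn_ge0 //; first by rewrite lerXn2r ?nnegrE.
apply: (@le_trans _ _ (2 ^+ j)); first by rewrite lerXn2r ?nnegrE.
by rewrite ler_eXn2l ?ltr1n.
Qed.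

(** By induction on the degree no approximant a/b is a root of [f]: as [x - a/b] is not
    infinitesimal, the linear factor could be divided out. So the integral multiple [F] of [f] is at
    least a power of 1/b at a/b, yet of order 1/[lcm_upto b] by the Lipschitz bound. *)
Lemma liouville_residue x : 0 <= x <= 2 ->
    (forall c, (0 < c)%N -> exists b a, [/\ (c < b)%N,
       (lcm_upto b)%:R * (x - a%:R / b%:R) < 1 &
       1 < 5 * (lcm_upto b)%:R * (x - a%:R / b%:R)]) ->
  forall f : {poly rat}, f != 0 -> ~ @infinitesimal K (map_poly ratr f).[x].
Proof.
move=> /andP[x0 x2] xL f; have [n] := ubnP (size f).
elim: n f => // n IH f fn f0 fx.
have approx_gt0 a b : 1 < 5 * (lcm_upto b)%:R * (x - a%:R / b%:R) ->
    0 < x - a%:R / b%:R.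
  move=> h; have y0 : 0 < 5 * (lcm_upto b)%:R :> K.
    by rewrite mulr_gt0 // ltr0n lcm_upto_gt0.
  by rewrite -(pmulr_rgt0 _ y0) (lt_trans _ h).
have no_root a b : 1 < 5 * (lcm_upto b)%:R * (x - a%:R / b%:R) ->
    ~~ root f (a%:R / b%:R).
  move=> h; apply/negP => /factor_theorem[g gE].
  have g0 : g != 0 by apply: contraNneq f0 => g0; rewrite gE g0 mul0r.
  apply: (IH g) => //.
    by move: fn; rewrite gE size_Mmonic ?monicXsubC // size_XsubC addn2.
  have -> : (map_poly ratr g).[x] = (map_poly ratr f).[x] * (x - a%:R / b%:R)^-1.
    have -> : map_poly ratr f = map_poly ratr g * ('X - (a%:R / b%:R)%:P) :> {poly K}.
      rewrite gE rmorphM; congr (_ * _).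
      transitivity ('X - (ratr (a%:R / b%:R) : K)%:P);
        first exact: map_polyXsubC.
      by rewrite ratr_frac.
    by rewrite hornerM hornerXsubC mulfK // gt_eqF // approx_gt0.
  apply: infinitesimalM => //; apply: bounded_inv => /(_ (5 * lcm_upto b)%N).
  rewrite gtr0_norm ?approx_gt0 // -[_ *+ (5 * _)]mulr_natl natrM => /(lt_trans h).
  by rewrite ltxx.
have [F [m m0 fE]] := rat_poly_scale f.
have fF (z : K) : (map_poly intr F).[z] = m%:~R * (map_poly ratr f).[z].
  have rm : ratr (m%:~R^-1) = (m%:~R)^-1 :> K.
    by rewrite -[in RHS]ratr_int; apply: fmorphV.
  rewrite fE map_polyZ hornerZ mulrA [X in _ * X * _]rm mulfV ?intr_eq0 // mul1r.
  by rewrite -map_poly_comp; congr _.[_]; apply: eq_map_poly => t; apply/esym;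
    exact: ratr_int.
have [B BP] := poly_lipschitz F.
have [C C0 CP] := lcm_upto_superpoly (size F).+1.
(* The exponent [(size F).+1] above leaves one spare factor [b], which has to beat these
   constants. *)
have [|b [a [cb xlt xgt]]] := xL (C * B.+1)%N; first by rewrite muln_gt0 C0.
have b0 : (0 < b)%N by apply: leq_trans cb.
set y := lcm_upto b in xlt xgt.
have Fx : infinitesimal (map_poly intr F).[x].
  by rewrite fF mulrC -ratr_int; apply: infinitesimalM (bounded_ratr _ _).
have bK : 0 < b%:R :> K by rewrite ltr0n.
have yK : 0 < y%:R :> K by rewrite ltr0n lcm_upto_gt0.
have dx := approx_gt0 _ _ xgt.
have r0 : 0 <= a%:R / b%:R :> K by rewrite divr_ge0 ?ler0n.
have Fr : (map_poly intr F).[a%:R / b%:R : K] != 0.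
  rewrite fF mulf_eq0 intr_eq0 negb_or m0 /=; apply: contra (no_root _ _ xgt).
  rewrite -ratr_frac => Fr; rewrite -(fmorph_root (@ratr K)); exact: Fr.
have := int_poly_frac_ge b0 Fr; set v := `|_| => v1.
have vle : y%:R * v <= 1 + B%:R.
  have rx : a%:R / b%:R <= x by rewrite -subr_ge0 ltW.
  have := BP x (a%:R / b%:R);
    rewrite (ger0_norm x0) (ger0_norm r0) (ger0_norm (ltW dx)).
  rewrite (le_trans rx x2) => /(_ x2 isT) BPx.
  have vx : v <= `|(map_poly intr F).[x]| + B%:R * (x - a%:R / b%:R).
    rewrite /v -[X in `|X|](subKr (map_poly intr F).[x]).
    by apply: le_trans (ler_normB _ _) _; rewrite lerD2l.
  have := Fx y; rewrite -[_ *+ y]mulr_natl => yF.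
  apply: le_trans (ler_wpM2l (ltW yK) vx) _; rewrite mulrDr lerD ?(ltW yF) //.
  by rewrite mulrCA ler_piMr ?ler0n // ltW.
have : (b ^ (size F).+1)%:R <= C%:R * (y%:R : K) by rewrite -natrM ler_nat CP.
rewrite natrX exprS => Cy.
have : b%:R <= (C * B.+1)%:R :> K.
  have := ler_wpM2l (ltW bK) v1; rewrite mulr1 => /le_trans; apply.
  rewrite mulrCA natrM; apply: le_trans (ler_wpM2l (normr_ge0 _) Cy) _.
  by rewrite mulrCA ler_pM2l ?ltr0n // mulrC -natr1 addrC.
by rewrite ler_nat leqNgt cb.
Qed.
End Liouville.

(** * Overspill *)

(** The bound variables 8, 9 and, in [F_lcm], 10 avoid the range 0 to 7 of [F_liouville], so nothing
    is captured. *)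
Definition F_common_multiple (z c : nat) : pa_formula :=
  FAll 8 (FImp (FAnd (FLt TZero (TVar 8)) (FLt (TVar 8) (TAdd (TVar c) TOne)))
    (FEx 9 (FEq (TVar z) (TMul (TVar 8) (TVar 9))))).

Definition F_lcm (z c : nat) : pa_formula :=
  FAnd (FLt TZero (TVar z)) (FAnd (F_common_multiple z c)
    (FAll 10 (FImp (FAnd (FLt TZero (TVar 10)) (F_common_multiple 10 c))
       (FNot (FLt (TVar 10) (TVar z)))))).

Definition T_five : pa_term :=
  TAdd TOne (TAdd TOne (TAdd TOne (TAdd TOne TOne))).

(* Variables: n = 0, p = 1, q = 2, c = 3, b = 4, a = 5, y = 6, z = 7. *)
Definition F_liouville : pa_formula :=
  FEx 1 (FEx 2 (FAnd (FAnd (FLt TZero (TVar 2)) (FLt (TVar 1) (TAdd (TVar 2) (TVar 2))))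
   (FAll 3 (FImp (FAnd (FLt TZero (TVar 3)) (FLt (TVar 3) (TVar 0)))
   (FEx 4 (FEx 5 (FEx 6 (FEx 7
     (FAnd (FAnd (F_lcm 7 3) (F_lcm 6 4))
     (FAnd (FAnd (FLt (TVar 3) (TVar 4)) (FLt (TVar 4) (TMul T_five (TVar 7))))
     (FAnd
       (FLt (TMul (TMul (TVar 6) (TVar 1)) (TVar 4))
            (TAdd (TMul (TMul (TVar 6) (TVar 2)) (TVar 5)) (TMul (TVar 2) (TVar 4))))
       (FLt (TAdd (TMul T_five (TMul (TMul (TVar 6) (TVar 2)) (TVar 5)))
                  (TMul (TVar 2) (TVar 4)))
            (TMul T_five (TMul (TMul (TVar 6) (TVar 1)) (TVar 4))))))))))))))).

(** * Standard and nonstandard elements of a discretely ordered cone *)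

Section Cone.
Context (K : realFieldType) (Z : subringClosed K).
Context (Zdisc : discretely_ordered Z).
Let M := nonneg_cone Z.

Lemma cone_ge0 (m : M) : 0 <= sval m.
Proof. by case: m => m /= /andP[]. Qed.

Lemma cone_in (m : M) : sval m \in Z.
Proof. by case: m => m /= /andP[]. Qed.

Lemma cone_inj (m n : M) : sval m = sval n -> m = n.
Proof. exact: val_inj. Qed.

Fact cone_nat_subproof n : cone_pred Z n%:R.
Proof. by rewrite /cone_pred rpred_nat ler0n. Qed.

Definition cone_nat n : M := exist (cone_pred Z) n%:R (cone_nat_subproof n).

(** By discreteness nothing lies strictly between [n] and [n + 1], so the standard elements form an
    initial segment. *)
Lemma cone_lt_nat (m : M) n : sval m < n%:R -> exists2 k, (k < n)%N & m = cone_nat k.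
Proof.
suff h : sval m < n%:R -> exists2 k, (k < n)%N & sval m = k%:R.
  by move=> /h[k kn mk]; exists k => //; apply: cone_inj.
elim: n => [|n IH]; first by rewrite ltNge cone_ge0.
case: (ltP (sval m) n%:R) => [/IH[k kn ->] _|nm mn1]; first by exists k => //;
  apply: leqW.
exists n => //; apply/eqP; rewrite -subr_eq0 eq_le subr_ge0 nm andbT leNgt.
apply/negP => /Zdisc h; have := h (rpredB (cone_in m) (rpred_nat _ _)).
by rewrite lerBrDl natr1 leNgt mn1.
Qed.

(** This and the next two predicates follow the formulas connective by connective, so that
    [sat_liouville] holds by conversion. *)
Definition is_common_multiple (z c : M) : Prop :=
  forall i : M, 0 < sval i /\ sval i < sval c + 1 -> exists w : M, z = pa_mul i w.

Definition is_lcm (z c : M) : Prop :=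
  0 < sval z /\ is_common_multiple z c /\
  forall t : M, 0 < sval t /\ is_common_multiple t c -> ~ sval t < sval z.

Definition is_liouville (n : M) : Prop :=
  exists p q : M, (0 < sval q /\ sval p < sval q + sval q) /\
   forall c : M, 0 < sval c /\ sval c < sval n ->
   exists b a y z : M, (is_lcm z c /\ is_lcm y b) /\
     ((sval c < sval b /\ sval b < (1 + (1 + (1 + (1 + 1)))) * sval z) /\
      (sval y * sval p * sval b < sval y * sval q * sval a + sval q * sval b /\
       (1 + (1 + (1 + (1 + 1)))) * (sval y * sval q * sval a) + sval q * sval b
         < (1 + (1 + (1 + (1 + 1)))) * (sval y * sval p * sval b))).

Lemma sat_liouville (e : nat -> M) n :
  pa_sat (upd e 0 n) F_liouville = is_liouville n.
Proof. by []. Qed.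

(** Divisors up to [c] and cofactors in [z] lie below standard elements, so quantifying over [M]
    adds nothing. *)
Lemma common_multiple_nat (z c : nat) :
  is_common_multiple (cone_nat z) (cone_nat c) <-> (lcm_upto c %| z)%N.
Proof.
split=> [zc|zc i [i0 ic]].
  apply: lcm_upto_dvdn => i /andP[i0 ic].
  have [|w zw] := zc (cone_nat i); first by rewrite /= natr1 ltr0n ltr_nat.
  have zE : z%:R = i%:R * sval w by rewrite -[LHS]/(sval (cone_nat z)) zw.
  have [k _ wk] : exists2 k, (k < z.+1)%N & w = cone_nat k.
    apply: cone_lt_nat; rewrite -natr1 (@le_lt_trans _ _ z%:R) ?ltrDl //.
    by rewrite zE ler_peMl ?cone_ge0 // ler1n.
  by apply/dvdnP; exists k; apply/eqP;
    rewrite -(eqr_nat K) zE wk /= natrM mulrC.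
move: ic; rewrite /= natr1 => /cone_lt_nat[k kc ik].
move: i0; rewrite ik ltr0n => k0.
have /dvdnP[m zm] : (k %| z)%N by apply: dvdn_trans zc; apply: dvdn_lcm_upto;
  rewrite k0.
by exists (cone_nat m); apply: cone_inj; rewrite /= zm natrM mulrC.
Qed.

(** Minimality bounds [z] by a standard element, so [z] is standard. *)
Lemma is_lcm_nat (z : M) (c : nat) :
  is_lcm z (cone_nat c) <-> z = cone_nat (lcm_upto c).
Proof.
have Lcm : is_common_multiple (cone_nat (lcm_upto c)) (cone_nat c).
  exact/common_multiple_nat.
have L0 : 0 < sval (cone_nat (lcm_upto c)) by rewrite ltr0n lcm_upto_gt0.
split=> [[z0 [zc zmin]]|->].
  have /negP := zmin _ (conj L0 Lcm); rewrite -leNgt => zL.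
  have [k kL zk] : exists2 k, (k < (lcm_upto c).+1)%N & z = cone_nat k.
    by apply: cone_lt_nat; rewrite -natr1 (le_lt_trans zL) // ltrDl.
  move: zc z0; rewrite zk ltr0n => /common_multiple_nat Lk k0.
  by congr cone_nat; apply/eqP; rewrite eqn_leq -ltnS kL dvdn_leq.
split=> //; split=> // t [t0 tc] tL.
have [k kL tk] := cone_lt_nat tL.
move: tc t0; rewrite tk ltr0n => /common_multiple_nat Lk k0.
by move: kL; rewrite ltnNge dvdn_leq.
Qed.

Lemma is_liouville_nat n : is_liouville (cone_nat n).
Proof.
have [p [q [q0 pq H]]] := liouville_approximants n.
exists (cone_nat p), (cone_nat q); split;
  first by rewrite /= -natrD ltr0n ltr_nat.
move=> c [c0 /= cn]; have [k kn ck] := cone_lt_nat cn.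
move: c0; rewrite {cn}ck ltr0n => k0.
have [b [a [kb bk h1 h2]]] := H k k0 kn.
exists (cone_nat b), (cone_nat a), (cone_nat (lcm_upto b)), (cone_nat (lcm_upto k)).
split; first by split; apply/is_lcm_nat.
have five : 1 + (1 + (1 + (1 + 1))) = 5%:R :> K by ring.
rewrite five; split; split; rewrite /= -?natrM -?natrD ?ltr_nat //.
Qed.

(** If no nonstandard element satisfied [is_liouville], the formula would define the standard
    elements, which are closed under successor; induction would then reach [N0]. *)
Lemma overspill_liouville : pa_induction M ->
  (exists N : M, forall k : nat, k%:R < sval N) ->
  exists2 N : M, (forall k : nat, k%:R < sval N) & is_liouville N.
Proof.
move=> ind [N0 N0big]; apply: contrapT => none; apply: (none).
exists N0 => //.
have e : nat -> M := fun=> N0.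
rewrite -(sat_liouville e); apply: (ind F_liouville 0%N e) => [|a].
  rewrite sat_liouville; have := is_liouville_nat 0; congr is_liouville.
  exact: cone_inj.
rewrite !sat_liouville => La.
have /existsNP[k /negP] : ~ forall k : nat, k%:R < sval a.
  by move=> abig; apply: (none); exists a.
rewrite -leNgt => ak.
have [|j _ ->] := @cone_lt_nat a k.+1;
  first by rewrite -natr1 (le_lt_trans ak) // ltrDl.
have := is_liouville_nat j.+1; congr is_liouville.
by apply: cone_inj; rewrite /= natr1.
Qed.

(** Take p/q. For standard [c] the bound on [b] by [5 * lcm_upto c] makes [b] standard, so
    Liouville's argument applies with genuine fractions. *)
Lemma liouville_transcendental (N : M) :
    (forall k : nat, k%:R < sval N) -> is_liouville N ->
  exists2 x : K, bounded x &
    forall f : {poly rat}, f != 0 -> ~ @infinitesimal K (map_poly ratr f).[x].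
Proof.
move=> Nbig [p [q [[q0 pq] H]]]; exists (sval p / sval q).
  exists 2%N; rewrite ger0_norm ?divr_ge0 ?cone_ge0 // ler_pdivrMr //.
  by rewrite mulr2n mulrDl mul1r ltW.
apply: liouville_residue.
  rewrite divr_ge0 ?cone_ge0 // ler_pdivrMr //.
  by rewrite mulr2n mulrDl mul1r ltW.
move=> c c0.
have [|b [a [y [z [[zc yb] [[cb bz] [h1 h2]]]]]]] := H (cone_nat c).
  by rewrite /= ltr0n.
move/is_lcm_nat: zc => zE; rewrite zE /= in bz.
have five : 1 + (1 + (1 + (1 + 1))) = 5%:R :> K by ring.
rewrite five in bz h2; move: bz; rewrite -natrM => /cone_lt_nat[k _ bk].
move: yb cb h1 h2; rewrite {b}bk => /is_lcm_nat -> /=; rewrite ltr_nat => ck.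
set L := lcm_upto k; have L0 : 0 < L%:R :> K by rewrite ltr0n lcm_upto_gt0.
have k0 : 0 < k%:R :> K by rewrite ltr0n (leq_ltn_trans _ ck).
move=> h1 h2.
(* By [h2] the fraction a/k is below p/q, which is below 2; hence [a] is standard. *)
have [j _ aj] : exists2 j, (j < 2 * k)%N & a = cone_nat j.
  apply: cone_lt_nat; rewrite natrM -(ltr_pM2l (mulr_gt0 L0 q0)).
  apply: (@lt_le_trans _ _ (L%:R * sval p * k%:R)).
    by have := mulr_gt0 q0 k0; lra.
  have -> : L%:R * sval q * (2 * k%:R) = L%:R * (sval q + sval q) * k%:R :> K.
    by ring.
  by rewrite ler_pM2r // ler_pM2l // ltW.
exists k, j; rewrite -/L; split=> //.
  rewrite aj /= -subr_gt0 in h1; rewrite -subr_gt0.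
  rewrite -(pmulr_lgt0 _ (mulr_gt0 q0 k0)); apply: etrans h1; congr (_ < _).
  by field; rewrite !gt_eqF.
rewrite aj /= -subr_gt0 in h2; rewrite -subr_gt0.
rewrite -(pmulr_lgt0 _ (mulr_gt0 q0 k0)); apply: etrans h2; congr (_ < _).
by field; rewrite !gt_eqF.
Qed.

End Cone.

Theorem corollary15 (G : oagType) (G_nonzero : exists g : G, g != 0)
    (G_divisible : divisible G) (G_exponential : exponential_group G) :
  exists K : rcfType,
    value_group_iso K G /\
    forall Z : subringClosed K,
      integer_part Z -> ~ peano_model (nonneg_cone Z).
Proof.
have [K [tau [tauP tau_asym residue_alg]]] := exists_monomial_field G_divisible.
exists K; split; first exact: monomial_value_group tauP tau_asym.
move=> Z [Zdisc Zfloor] [_ ind].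
(* For negative [g] the monomial [tau g] exceeds every natural number, and its integer part is a
   nonstandard element of the cone. *)
have [g g0] : exists g : G, g < 0.
  have [g g0] := G_nonzero; case: (oag_lt_total g 0) => gs; first by exists g.
    by rewrite gs eqxx in g0.
  by exists (- g); rewrite oag_oppr_lt0.
have tau_big (k : nat) : k%:R < tau g.
  by have [_ _ /(_ _ _ g0 k)] := tauP; rewrite (monomial0 tauP).
have [z Zz /andP[_ tz]] := Zfloor (tau g).
have z_big (k : nat) : k%:R < z.
  by rewrite -(ltrD2r 1) natr1 (lt_trans _ tz).
have zcone : cone_pred Z z by rewrite /cone_pred Zz ltW // (z_big 0%N).
have [|N Nbig NL] := overspill_liouville Zdisc ind.
  by exists (exist (cone_pred Z) z zcone).
(* The residue of this [x] is transcendental, against [residue_alg]. *)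
have [x xb xt] := liouville_transcendental Zdisc Nbig NL.
by have [f f0 /(xt _ f0)] := residue_alg x xb.
Qed.
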